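(* The relation $\approx_p$ of permutative equivalence between unconditional basic sequences is a complete analytic equivalence relation: it is analytic, and every analytic equivalence relation on a standard Borel space Borel reduces to it.
   Context: The standard Borel space $\mathcal{UBS}$ of unconditional basic sequences is the set of subsequences $(u_n)_{n\in N}$, $N\in[\omega]^\omega$, of Pełczyński's universal unconditional basic sequence $(u_n)_{n\in\omega}$ (identified with $[\omega]^\omega$). Two basic sequences $(x_i)$, $(y_i)$ are equivalent, $(x_i)\approx(y_i)$, if $\sum a_ix_i$ converges iff $\sum a_iy_i$ converges; they are permutatively equivalent, $(x_i)\approx_p(y_i)$, if $(x_i)\approx(y_{f(i)})$ for some permutation $f$ of $\mathbb N$. $E$ Borel reduces to $F$ if there is a Borel $f$ with $xEy\iff f(x)Ff(y)$. *)

(* Defs.v *)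
From HB Require Import structures.
From mathcomp Require Import all_boot all_order all_algebra.
From mathcomp Require Import all_classical all_reals all_analysis.
Set Implicit Arguments. Unset Strict Implicit. Unset Printing Implicit Defensive.
Import Order.TTheory GRing.Theory Num.Theory.
Import numFieldNormedType.Exports.
Local Open Scope classical_set_scope.
Local Open Scope ring_scope.

Definition polish_space (R : realType) (T : topologicalType) : Prop :=
  (exists D : set T, countable D /\ dense D) /\
  exists d : T -> T -> R,
    [/\ forall x y, d x y = 0 <-> x = y,
        forall x y, d x y = d y x,
        forall x y z, d x z <= d x y + d y z,
        forall A : set T, open A <->
          (forall x, A x -> exists2 e : R, 0 < e & [set y | d x y < e] `<=` A)
      & forall s : nat -> T,
          (forall e : R, 0 < e -> exists N : nat, forall m n : nat,
              (N <= m)%N -> (N <= n)%N -> d (s m) (s n) < e) ->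
          exists l : T, s @ \oo --> l ].

Definition borel_set (T : topologicalType) : set (set T) := <<s @open T >>.

Definition borel_fun (T U : topologicalType) (f : T -> U) : Prop :=
  forall B : set U, open B -> borel_set (f @^-1` B).

Definition baire_space : Type := prod_topology (fun _ : nat => nat).
HB.instance Definition _ := Topological.on baire_space.

Definition analytic_set (T : topologicalType) (A : set T) : Prop :=
  A = set0 \/ exists f : baire_space -> T, continuous f /\ range f = A.

Definition equiv_relation (T : Type) (E : T -> T -> Prop) : Prop :=
  [/\ forall x, E x x, forall x y, E x y -> E y x
    & forall x y z, E x y -> E y z -> E x z].

Definition infinite_omega (N : nat -> bool) : Prop :=
  forall m : nat, exists n : nat, (m <= n)%N /\ N n.

Definition enumerates (N : nat -> bool) (s : nat -> nat) : Prop :=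
  (forall n, (s n < s n.+1)%N) /\ (forall k, N k <-> exists n, s n = k).

Section Banach.
Variables (R : realType).

Definition lin_span (V : normedModType R) (x : nat -> V) : set V :=
  [set y | exists (n : nat) (a : nat -> R), y = \sum_(i < n) a i *: x i].

Definition basic_seq (V : normedModType R) (x : nat -> V) : Prop :=
  forall y, closure (lin_span x) y ->
    exists! a : nat -> R, series (fun i => a i *: x i) @ \oo --> y.

Definition unconditional_basic_seq (V : normedModType R) (x : nat -> V) : Prop :=
  basic_seq x /\
  forall a : nat -> R, cvg (series (fun i => a i *: x i) @ \oo) ->
    forall p : nat -> nat, bijective p ->
      cvg (series (fun i => a (p i) *: x (p i)) @ \oo).

Definition seq_equiv (V W : normedModType R) (x : nat -> V) (y : nat -> W) : Prop :=
  forall a : nat -> R,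
    cvg (series (fun i => a i *: x i) @ \oo) <-> cvg (series (fun i => a i *: y i) @ \oo).

Definition perm_equiv (V W : normedModType R) (x : nat -> V) (y : nat -> W) : Prop :=
  exists f : nat -> nat, bijective f /\ seq_equiv x (y \o f).

Definition universal_unconditional (V : completeNormedModType R) (u : nat -> V) : Prop :=
  unconditional_basic_seq u /\
  forall (W : completeNormedModType R) (x : nat -> W), unconditional_basic_seq x ->
    exists s : nat -> nat, (forall n, (s n < s n.+1)%N) /\ seq_equiv x (u \o s).

(** permutative equivalence on UBS, identified with [omega]^omega:
    N ~ M iff (u_n)_{n in N} ≈_p (u_n)_{n in M}. *)
Definition ubs_perm_equiv (V : completeNormedModType R) (u : nat -> V)
    (N M : nat -> bool) : Prop :=
  exists s t : nat -> nat,
    [/\ enumerates N s, enumerates M t & perm_equiv (u \o s) (u \o t)].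

End Banach.

(* Main.v *)
Require Import Defs.
From HB Require Import structures.
From mathcomp Require Import all_boot all_order all_algebra.
From mathcomp Require Import all_classical all_reals all_analysis.
From mathcomp Require Import zify ring lra.
Import Order.TTheory GRing.Theory Num.Theory.
Import numFieldNormedType.Exports.
Set Implicit Arguments.
Unset Strict Implicit.
Unset Printing Implicit Defensive.
Local Open Scope classical_set_scope.
Local Open Scope ring_scope.

(** Analyticity: by a gliding hump, equivalence of two basic sequences amounts to a
    domination of finite partial sums with some integer constant, a closed condition
    on the enumerations, the permutation and the constant.

    Completeness: let [E] be an analytic equivalence relation, the points being coded
    by elements of the Cantor space.  Following Louveau and Rosendal, let
    [approx n b p q] say that [p] and [q] are joined, up to precision [n], by a chain of
    [b 0] approximate [E]-steps whose witnesses are bounded by [b].  These relations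
    satisfy [approx n b p q -> approx n c q r -> approx n (b + c) p r], and by compactness
    [E x y] holds iff some [b] satisfies [approx n b x y] for all [n].  Let [T_x] be the
    tree of the pairs [(u, s)] of finite sequences of the same length [n] such that
    [approx n s u x].  To each node [t = (u, s)] attach infinitely many basis vectors,
    spanning a space with a symmetric norm whose growth exponent [gam u] in ]0, 1[
    determines [u], and sum these norms along chains of comparable sequences [s].  The
    basis vectors attached to [T_x], inside a single unconditional basic sequence, are the
    image of [x].

    If [E x y] then [(u, s) |-> (u, s + b)] embeds [T_x] isometrically in [T_y], and
    symmetrically, so that a Cantor-Bernstein argument gives a permutative equivalence.
    Conversely, by Ramsey's theorem every infinite set of basis vectors contains a
    sequence whose growth exponent is 0 (incomparable nodes), 1 (a chain) or [gam u] (a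
    single node).  A permutative equivalence preserves exponents, hence labels [u] and
    chains; the image of the branch [(x|n, 0^n)] of [T_x] thus contains a chain of nodes
    [(x|n, b|n)] of [T_y], and [E x y].  *)

(** * Domination between sequences of vectors *)

Section SeriesDomination.
Variable R : realType.

Lemma cvg_series_tailP (V : completeNormedModType R) (f : nat -> V) :
  cvg (series f @ \oo) <->
  forall e : R, 0 < e -> exists N, forall n, (N <= n)%N ->
    `|series f n - series f N| <= e.
Proof.
split.
  move=> /cvg_ex[l /cvgrPdist_le fl] e e0.
  have e2 : 0 < e / 2 by rewrite divr_gt0.
  have [N _ HN] := fl _ e2.
  exists N => n Nn.
  rewrite -(subrKA l) [e]splitr (le_trans (ler_normD _ _))//.
  by rewrite distrC lerD// ?HN//= ?leqnn.
move=> H; apply: cauchy_cvg; apply: cauchy_exP => e e0.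
have e2 : 0 < e / 2 by rewrite divr_gt0.
have [N HN] := H _ e2; exists (series f N), N => // n /= Nn.
rewrite -ball_normE /= distrC (le_lt_trans (HN _ Nn))//.
by rewrite ltr_pdivrMr// mulr2n mulrDr mulr1 ltrDl.
Qed.

Lemma seriesE (V : normedModType R) (f : nat -> V) n :
  series f n = \sum_(i < n) f i.
Proof. by rewrite /series /= big_mkord. Qed.

Definition combo (V : lmodType R) (x : nat -> V) (a : nat -> R) (n : nat) : V :=
  \sum_(i < n) a i *: x i.

Lemma series_combo (V : normedModType R) (x : nat -> V) a :
  series (fun i => a i *: x i) = combo x a.
Proof. by apply/funext => n; rewrite seriesE. Qed.

(** Bounding every partial sum up to [n], and not only the last one, matches the Cauchy criterion.
    For fixed [a] and [n] only finitely many vectors occur, which makes domination by a given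
    constant a closed condition on the sequences. *)
Definition dominated (V W : normedModType R) (x : nat -> V) (y : nat -> W) (K : R) :=
  forall a n, (forall k, (k <= n)%N -> `|combo x a k| <= 1) -> `|combo y a n| <= K.

Definition cutoff (m n : nat) (a : nat -> R) : nat -> R :=
  fun i => if (m <= i < n)%N then a i else 0.

Lemma comboS (V : lmodType R) (x : nat -> V) a n :
  combo x a n.+1 = combo x a n + a n *: x n.
Proof. by rewrite /combo big_ord_recr. Qed.

Lemma combo_eq0 (V : lmodType R) (x : nat -> V) a n :
  (forall i, (i < n)%N -> a i = 0) -> combo x a n = 0.
Proof. by move=> H; rewrite /combo big1// => i _; rewrite H// scale0r. Qed.

Lemma eq_combo (V : lmodType R) (x : nat -> V) a b n :
  (forall i, (i < n)%N -> a i = b i) -> combo x a n = combo x b n.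
Proof. by move=> H; apply: eq_bigr => i _; rewrite H. Qed.

Lemma comboZ (V : lmodType R) (x : nat -> V) c a n :
  combo x (fun i => c * a i) n = c *: combo x a n.
Proof. by rewrite /combo scaler_sumr; apply: eq_bigr => i _; rewrite scalerA. Qed.

Lemma combo_cutoff (V : lmodType R) (x : nat -> V) m n a k :
  combo x (cutoff m n a) k =
  if (m <= n)%N then combo x a (minn k n) - combo x a (minn k (minn m n)) else 0.
Proof.
elim: k => [|k IH].
  by rewrite !min0n /combo big_ord0 subrr; case: ifP.
rewrite comboS IH /cutoff.
case: (leqP m n) => mn; last first.
  by case: ifPn; [lia | rewrite scale0r addr0].
case: (boolP (m <= k)%N) => mk /=; last first.
  rewrite scale0r addr0.
  by rewrite !(minn_idPl _) ?subrr//; lia.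
rewrite !(minn_idPr (_ : m <= _)%N); [|lia|lia].
case: (boolP (k < n)%N) => kn.
  rewrite !(minn_idPl (_ : _ <= n)%N); [|lia|lia].
  by rewrite comboS addrAC.
by rewrite !(minn_idPr (_ : n <= _)%N) ?scale0r ?addr0//; lia.
Qed.

Lemma dominated_cvg (V' : completeNormedModType R)
  (W : completeNormedModType R) (x : nat -> V') (y : nat -> W) (K : R) :
  dominated x y K -> forall a, cvg (series (fun i => a i *: x i) @ \oo) ->
    cvg (series (fun i => a i *: y i) @ \oo).
Proof.
move=> dom a /cvg_series_tailP cx; apply/cvg_series_tailP => e e0.
(* [|K| + 1] is a positive substitute for [K]. A tail of the [x]-series below [e / (|K| + 1)],
   rescaled by the inverse [c], satisfies the hypothesis of domination. *)
have K1 : 0 < `|K| + 1 by rewrite ltr_wpDl.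
have eK : 0 < e / (`|K| + 1) by rewrite divr_gt0.
have [N HN] := cx _ eK.
exists N => n Nn; rewrite !series_combo in HN *.
pose c := (e / (`|K| + 1))^-1.
have c0 : 0 < c by rewrite invr_gt0.
have := dom (fun i => c * cutoff N n a i) n.
rewrite comboZ combo_cutoff Nn minnn (minn_idPl Nn) (minn_idPr Nn) normrZ gtr0_norm//.
move=> H; have {}H : c * `|combo y a n - combo y a N| <= K.
  apply: H => k kn.
  rewrite comboZ combo_cutoff Nn normrZ gtr0_norm// (minn_idPl kn) (minn_idPl Nn).
  rewrite -ler_pdivlMl// invrK mulr1.
  have [kN|/ltnW Nk] := leqP k N; first by rewrite subrr normr0 ltW.
  exact: HN.
rewrite -ler_pdivlMl// invrK in H.
apply: (le_trans H); rewrite mulrAC ler_pdivrMr// ler_pM2l//.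
by rewrite (le_trans (ler_norm K))// lerDl.
Qed.

(** * The gliding hump argument *)

Section GlidingHump.
Variables (V W : completeNormedModType R) (x : nat -> V) (y : nat -> W).
Hypothesis x_neq0 : forall i, x i != 0.
Hypothesis xy : forall a, cvg (series (fun i => a i *: x i) @ \oo) ->
  cvg (series (fun i => a i *: y i) @ \oo).

Let hump (m K : nat) (p : (nat -> R) * nat) :=
  [/\ forall i, (i < m)%N -> p.1 i = 0, forall i, (p.2 <= i)%N -> p.1 i = 0,
    forall k, `|combo x p.1 k| <= 1, K%:R < `|combo y p.1 p.2| & (m <= p.2)%N].

Hypothesis undominated : forall K : nat, ~ dominated x y K%:R.

(** Coefficients violating domination for a much larger constant are erased before [m]; the erased
    part is bounded in advance, so a large [y]-sum remains. *)
Lemma hump_exists m K : exists p, hump m K p.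
Proof.
(* [C] bounds the [y]-sums of length at most [m]: each term [a i *: x i] is a difference of two
   partial sums in the unit ball, so [a i] is at most [2 / |x i|]. *)
pose C := \sum_(i < m) 2 / `|x i| * `|y i|.
have [K' HK'] : exists K' : nat, 2 * K%:R + C <= K'%:R.
  exists (Num.truncn (2 * K%:R + C)).+1; apply: ltW; exact: truncnS_gt.
have /existsNP[a /existsNP[n]] := @undominated K'.
move=> /not_implyP[ha /negP]; rewrite -ltNge => hK.
have small i : (i < n)%N -> `|a i| <= 2 / `|x i|.
  move=> i_n; rewrite ler_pdivlMr ?normr_gt0// -normrZ.
  have -> : a i *: x i = combo x a i.+1 - combo x a i.
    by rewrite comboS addrC addKr.
  by rewrite (le_trans (ler_normB _ _))// -[2]/(1 + 1) lerD// ha// ltnW.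
have bound j : (j <= m)%N -> (j <= n)%N -> `|combo y a j| <= C.
  move=> jm jn; rewrite (le_trans (ler_norm_sum _ _ _))// /C.
  rewrite -(big_mkord xpredT (fun i => 2 / `|x i| * `|y i|)).
  rewrite -(big_mkord xpredT (fun i => `|a i *: y i|)).
  rewrite [leRHS](@big_cat_nat _ _ _ j)//= -[leLHS]addr0 lerD//.
    rewrite !big_nat; apply: ler_sum => i ij.
    by rewrite normrZ ler_wpM2r// small//; lia.
  by apply: sumr_ge0 => i _; rewrite !mulr_ge0.
have mn : (m <= n)%N.
  rewrite leqNgt; apply/negP => nm.
  have := bound n (ltnW nm) (leqnn _); rewrite leNgt => /negP; apply.
  apply: le_lt_trans hK; rewrite (le_trans _ HK')// lerDr.
  by rewrite mulr_ge0.
(* Cutting off may double the [x]-sums; the factor 1/2 compensates, and is paid for by the [2 * K]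
   inside [K']. *)
exists (fun i => 2^-1 * cutoff m n a i, n); split => //=.
- by move=> i im; rewrite /cutoff leqNgt im/= mulr0.
- by move=> i ni; rewrite /cutoff [(i < n)%N]ltnNge ni andbF mulr0.
- move=> k; rewrite comboZ combo_cutoff mn normrZ ger0_norm// ler_pdivrMl//.
  by rewrite mulr1 (le_trans (ler_normB _ _))// -[2]/(1 + 1) lerD// ha//; lia.
rewrite comboZ combo_cutoff mn minnn (minn_idPl mn) (minn_idPr mn).
rewrite normrZ ger0_norm// ltr_pdivlMl//.
rewrite (lt_le_trans _ (lerB_dist _ _))// ltrBrDr.
apply: le_lt_trans hK; apply: le_trans HK'.
by rewrite lerD2l bound.
Qed.

Let hp m K := xget (fun=> 0, 0%N) [set p | hump m K p].

Let hpP m K : hump m K (hp m K).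
Proof.
have [p Hp] := hump_exists m K.
by rewrite /hp; case: xgetP => [q _ //|/(_ p)/(_ Hp)].
Qed.

Fixpoint hump_start k : nat :=
  if k is k'.+1 then (hp (hump_start k') (2 ^ k')).2.+1 else 0%N.

Let M := hump_start.
Let A k := (hp (M k) (2 ^ k)).1.

Let AP k : [/\ forall i, (i < M k)%N -> A k i = 0,
  forall i, (M k.+1 <= i)%N -> A k i = 0,
  forall n, `|combo x (A k) n| <= 1 & (2 ^ k)%:R < `|combo y (A k) (M k.+1)|].
Proof.
have [h1 h2 h3 h4 h5] := hpP (M k) (2 ^ k); split => //.
  by move=> i /= /ltnW; exact: h2.
have -> // : combo y (A k) (M k.+1) = combo y (hp (M k) (2 ^ k)).1 (hp (M k) (2 ^ k)).2.
by rewrite /A {2}/M [hump_start k.+1]/= -/(M k) comboS (h2 _ (leqnn _)) scale0r addr0.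
Qed.

Let M_lt k : (M k < M k.+1)%N.
Proof. by have [_ _ _ _] := hpP (M k) (2 ^ k); rewrite /M /= ltnS. Qed.

Let M_le k l : (k <= l)%N -> (M k <= M l)%N.
Proof.
elim: l => [|l IH]; first by rewrite leqn0 => /eqP ->.
rewrite leq_eqVlt => /predU1P[->//|]; rewrite ltnS => /IH h.
by rewrite (leq_trans h)// ltnW.
Qed.

Let M_ge k : (k <= M k)%N.
Proof. by elim: k => // k IH; rewrite (leq_ltn_trans IH). Qed.

(** The sum of all humps, the [k]-th weighted by 2^-k. Indices [k <= i] are enough because hump [k]
    starts at [M k >= k]. *)
Let tot i := \sum_(k < i.+1) 2^-1 ^+ k * A k i.

Let combo_tot (U : lmodType R) (z : nat -> U) n N : (n <= N)%N ->
  combo z tot n = \sum_(k < N) 2^-1 ^+ k *: combo z (A k) n.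
Proof.
move=> nN; rewrite /combo.
under [RHS]eq_bigr do rewrite scaler_sumr.
rewrite exchange_big/=; apply: eq_bigr => -[i /= i_n] _.
under eq_bigr do rewrite scalerA.
rewrite -scaler_suml; congr (_ *: _); rewrite /tot.
have iN : (i.+1 <= N)%N by exact: leq_trans nN.
rewrite -(big_mkord xpredT (fun k => 2^-1 ^+ k * A k i)).
rewrite -(big_mkord xpredT (fun k => 2^-1 ^+ k * A k i)).
rewrite [RHS](@big_cat_nat _ _ _ i.+1)//= [X in _ + X]big1_seq ?addr0//.
move=> k /andP[_]; rewrite mem_index_iota => /andP[ik _].
have [-> //] := AP k; first by rewrite mulr0.
exact: leq_trans (M_ge k).
Qed.

Let combo_before (U : lmodType R) (z : nat -> U) k n : (n <= M k)%N ->
  combo z (A k) n = 0.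
Proof.
by move=> nk; apply: combo_eq0 => i i_n; have [-> //] := AP k; exact: leq_trans nk.
Qed.

Let combo_after (U : lmodType R) (z : nat -> U) k n : (M k.+1 <= n)%N ->
  combo z (A k) n = combo z (A k) (M k.+1).
Proof.
move=> kn; rewrite /combo.
rewrite -(big_mkord xpredT (fun i => A k i *: z i)) (@big_cat_nat _ _ _ (M k.+1))//=.
rewrite big_mkord [X in _ + X]big1_seq ?addr0// => i.
rewrite mem_index_iota => /andP[_ /andP[ki _]].
by have [_ -> //] := AP k; rewrite scale0r.
Qed.

Let geometric_tail l n :
  \sum_(k < n) (if (k < l)%N then 0 else 2^-1 ^+ k) <= 2 * 2^-1 ^+ l :> R.
Proof.
suff : \sum_(k < n) (if (k < l)%N then 0 else 2^-1 ^+ k) <=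
    2 * 2^-1 ^+ l - 2 * 2^-1 ^+ (maxn n l) :> R.
  by move=> h; rewrite (le_trans h)// gerBl mulr_ge0// exprn_ge0.
elim: n => [|n IH]; first by rewrite big_ord0 max0n subrr.
rewrite big_ord_recr/=; case: (boolP (n < l)%N) => nl.
  by rewrite addr0 (maxn_idPr nl); rewrite (maxn_idPr (ltnW nl)) in IH.
rewrite -leqNgt in nl.
rewrite (maxn_idPl (leqW nl)); rewrite (maxn_idPl nl) in IH.
rewrite (le_trans (lerD IH (lexx _)))// exprS; lra.
Qed.

(** For [x], hump [k] changes the partial sums by at most 2 * 2^-k, so the series of [tot]
    converges. For [y], block [N] alone contributes more than 2^-N * 2^N = 1, against the Cauchy
    criterion. *)
Lemma undominated_absurd : False.
Proof.
have cx : cvg (series (fun i => tot i *: x i) @ \oo).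
  apply/cvg_series_tailP => e e0; rewrite series_combo.
  have [l hl] : exists l : nat, 4 * 2^-1 ^+ l <= e.
    have [l hl] : exists l : nat, 4 / e <= l%:R :> R.
      by exists (Num.truncn (4 / e)).+1; apply: ltW; exact: truncnS_gt.
    exists l; rewrite exprVn ler_pdivrMr ?exprn_gt0// mulrC -ler_pdivrMr//.
    by rewrite (le_trans hl)// -natrX ler_nat ltnW// ltn_expl.
  exists (M l) => n ln.
  rewrite !(@combo_tot _ _ _ n)// -sumrB.
  apply: le_trans hl; apply: le_trans (ler_norm_sum _ _ _) _.
  have -> : 4 = 2 * 2 :> R by rewrite -natrM.
  rewrite -mulrA; apply: le_trans (ler_wpM2l _ (geometric_tail l n)) => //.
  rewrite mulr_sumr; apply: ler_sum => k _.
  rewrite -scalerBr normrZ ger0_norm ?exprn_ge0//.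
  case: ifPn => kl.
    rewrite (combo_after _ (_ : M k.+1 <= n)%N) ?(combo_after _ (_ : M k.+1 <= M l)%N).
    - by rewrite subrr normr0 !mulr0.
    - exact: M_le.
    - by apply: leq_trans ln; exact: M_le.
  rewrite mulrC ler_wpM2r ?exprn_ge0//.
  have [_ _ h _] := AP k.
  by rewrite (le_trans (ler_normB _ _))// -[2]/(1 + 1) lerD.
have /cvg_series_tailP := xy cx; rewrite series_combo.
have e0 : 0 < 4^-1 :> R by rewrite invr_gt0.
move=> /(_ _ e0)[N HN].
have h1 := HN _ (M_ge N).
have h2 : `|combo y tot (M N.+1) - combo y tot N| <= 4^-1.
  by apply: HN; rewrite (leq_trans (M_ge N))// ltnW.
have : `|combo y tot (M N.+1) - combo y tot (M N)| <= 2^-1.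
  rewrite -(subrKA (combo y tot N)) (le_trans (ler_normD _ _))//.
  rewrite [`|combo y tot N - _|]distrC (le_trans (lerD h2 h1))//; lra.
rewrite !(@combo_tot _ _ _ (M N.+1))//; last exact/ltnW/M_lt.
rewrite -sumrB.
have NM : (N < M N.+1)%N by exact: leq_ltn_trans (M_ge N) (M_lt N).
rewrite (bigD1 (Ordinal NM))//= big1 ?addr0 => [|k /eqP kN].
  rewrite (combo_before _ (leqnn _)) scaler0 subr0 normrZ.
  rewrite ger0_norm ?exprn_ge0// exprVn ler_pdivrMl ?exprn_gt0//.
  have [_ _ _ h] := AP N.
  rewrite leNgt => /negP; apply; apply: le_lt_trans h.
  rewrite natrX ger_pMr ?exprn_gt0//; lra.
have {}kN : k <> N :> nat by move=> h; apply: kN; exact: val_inj.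
rewrite -scalerBr; have [kl|lk] := ltnP k N.
  rewrite (combo_after _ (_ : M k.+1 <= M N)%N) ?(combo_after _ (_ : M k.+1 <= M N.+1)%N).
  - by rewrite subrr scaler0.
  - by apply: M_le; exact: leqW.
  - exact: M_le.
have NSk : (N.+1 <= k)%N by lia.
rewrite (combo_before _ (M_le NSk)) combo_before ?subrr ?scaler0//.
by apply: M_le; exact: ltnW.
Qed.

End GlidingHump.

Lemma series_implies_dominated (V W : completeNormedModType R) (x : nat -> V)
    (y : nat -> W) : (forall i, x i != 0) ->
  (forall a, cvg (series (fun i => a i *: x i) @ \oo) ->
     cvg (series (fun i => a i *: y i) @ \oo)) ->
  exists K : nat, dominated x y K%:R.
Proof.
move=> x0 xy; apply: contrapT => /forallNP nd.
exact: (undominated_absurd x0 xy nd).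
Qed.

Lemma seq_equivP (V W : completeNormedModType R) (x : nat -> V) (y : nat -> W) :
  (forall i, x i != 0) -> (forall i, y i != 0) ->
  seq_equiv x y <-> exists K : nat, dominated x y K%:R /\ dominated y x K%:R.
Proof.
move=> x0 y0; split=> [xy|[K [xy yx]] a]; last first.
  by split; apply: dominated_cvg; eassumption.
have [K1 h1] := series_implies_dominated x0 (fun a => (xy a).1).
have [K2 h2] := series_implies_dominated y0 (fun a => (xy a).2).
exists (maxn K1 K2); split => a n ha.
  by rewrite (le_trans (h1 a n ha))// ler_nat leq_maxl.
by rewrite (le_trans (h2 a n ha))// ler_nat leq_maxr.
Qed.

(** If [x i = 0], the zero sequence and the indicator of [i] both expand 0, against uniqueness. *)
Lemma basic_seq_neq0 (V : normedModType R) (x : nat -> V) :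
  basic_seq x -> forall i, x i != 0.
Proof.
move=> bx i; apply/eqP => xi0.
have cl0 : closure (lin_span x) 0.
  apply: subset_closure; exists 0%N, (fun=> 0); by rewrite big_ord0.
have [a [ha ua]] := bx _ cl0.
have zero b : (forall n, combo x b n = 0) -> series (fun i => b i *: x i) @ \oo --> 0.
  by move=> hb; rewrite series_combo (_ : combo x b = fun=> 0);
    [exact: cvg_cst | apply/funext].
have a0 : a = fun=> 0 by apply: ua; apply: zero => n; exact: combo_eq0.
have : a = fun j => (j == i)%:R.
  apply: ua; apply: zero => n; rewrite /combo big1// => j _.
  by case: eqP => [->|_]; rewrite ?xi0 ?scaler0 ?scale0r.
rewrite a0 => /(congr1 (fun f => f i)) /eqP; rewrite eqxx eq_sym oner_eq0.
by [].
Qed.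

End SeriesDomination.

(** * Sequence spaces and analytic sets *)

Section SequenceSpaces.

Definition agree (T : Type) (n : nat) (x y : nat -> T) :=
  forall i, (i < n)%N -> x i = y i.

Lemma agree_sym (T : Type) n (x y : nat -> T) : agree n x y -> agree n y x.
Proof. by move=> h i /h. Qed.

Lemma agree_trans (T : Type) n (x y z : nat -> T) :
  agree n x y -> agree n y z -> agree n x z.
Proof. by move=> h h' i i_n; rewrite h// h'. Qed.

Lemma agree_le (T : Type) m n (x y : nat -> T) :
  (m <= n)%N -> agree n x y -> agree m x y.
Proof. by move=> mn h i im; apply: h; exact: leq_trans mn. Qed.

Lemma cvg_seq_space (T : topologicalType) (F : set_system (prod_topology (fun _ : nat => T)))
    (x : prod_topology (fun _ : nat => T)) : Filter F ->
  (forall i, (fun y : prod_topology (fun _ : nat => T) => y i) @ F --> x i) -> F --> x.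
Proof.
move=> FF h; apply/cvg_sup => i A [B [[C oC <-]] Cx BA].
apply: filterS BA _; apply: (h i); exact: open_nbhs_nbhs.
Qed.

(** Otherwise points outside [A] agreeing with [x] on longer and longer prefixes would converge to
    [x] coordinatewise, hence in the product topology. *)
Lemma nbhs_seq_space (T : topologicalType) (x : prod_topology (fun _ : nat => T))
    (A : set (prod_topology (fun _ : nat => T))) :
  nbhs x A -> exists n, forall y : nat -> T, agree n x y -> A y.
Proof.
move=> Ax; apply: contrapT => /forallNP h.
have {}h n : exists y : nat -> T, agree n x y /\ ~ A y.
  by have /existsNP[y /not_implyP[]] := h n; exists y.
have [y hy] := choice h.
have cy : (y : nat -> prod_topology (fun _ : nat => T)) @ \oo --> x.
  apply: cvg_seq_space => i B Bx; exists i.+1 => // n /= i_n.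
  by rewrite -(hy n).1//; exact: nbhs_singleton.
have [N _ /(_ N (leqnn _))] := cy _ Ax.
exact: (hy N).2.
Qed.

Lemma nbhs_cylinder (T : discreteTopologicalType) (x : prod_topology (fun _ : nat => T)) n :
  nbhs x (agree n x : set (prod_topology (fun _ : nat => T))).
Proof.
have FF : Filter (nbhs x) := nbhs_filter x.
elim: n => [|n IH]; first exact: (filterS _ filterT).
have nx : nbhs x [set y : prod_topology (fun _ : nat => T) | y n = x n].
  exact: (@proj_continuous nat (fun=> T : topologicalType) n x [set x n] (discrete_set1 _)).
apply: filterS (filterI IH nx) => y [h1 /= h2] i.
by rewrite ltnS leq_eqVlt => /predU1P[->//|/h1].
Qed.

Lemma finitary_continuous (T U : discreteTopologicalType)
    (F : prod_topology (fun _ : nat => T) -> prod_topology (fun _ : nat => U)) :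
  (forall x i, exists n, forall y, agree n x y -> F x i = F y i) -> continuous F.
Proof.
move=> h x; have FF : Filter (nbhs x) := nbhs_filter x.
apply: cvg_seq_space => i B Bx.
have [n hn] := h x i.
apply: filterS (nbhs_cylinder x n) => y /hn/= <-; exact: nbhs_singleton.
Qed.

(** * Retraction of the Baire space onto a nonempty closed subset *)

Section Retraction.
Variable C : set (nat -> nat).
Hypothesis C_closed : forall x, (forall n, exists y, C y /\ agree n x y) -> C x.
Variable c0 : nat -> nat.
Hypothesis Cc0 : C c0.

Let ext (l : seq nat) := [set c | C c /\ l = mkseq c (size l)].
(** The proposed letter is kept as long as the prefix still extends to a point of [C]; otherwise it
    is replaced by the letter of some point of [C] extending the current prefix. Points of [C] are
    thus fixed, and each output letter depends on a finite prefix. *)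
Let next (l : seq nat) (d : nat) : nat :=
  if `[< ext (rcons l d) !=set0 >] then d else xget c0 (ext l) (size l).
Let Fixpoint prefixes (x : nat -> nat) (n : nat) : seq nat :=
  if n is m.+1 then rcons (prefixes x m) (next (prefixes x m) (x m)) else [::].

Definition retract (x : nat -> nat) : nat -> nat :=
  fun n => next (prefixes x n) (x n).

Let prefixesE x n : prefixes x n = mkseq (retract x) n.
Proof. by elim: n => //= n IH; rewrite mkseqS -IH. Qed.

Let ext_next l d : ext l !=set0 -> ext (rcons l (next l d)) !=set0.
Proof.
move=> [c [Cc lc]]; rewrite /next; case: asboolP => // _.
have : ext l (xget c0 (ext l)) by case: xgetP => [c' _ //|/(_ c)[]].
set c' := xget _ _ => -[Cc' lc'].
by exists c'; split => //; rewrite size_rcons mkseqS -lc'.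
Qed.

Let ext_retract x n : ext (mkseq (retract x) n) !=set0.
Proof.
elim: n => [|n IH]; first by exists c0; split.
by rewrite mkseqS {2}/retract prefixesE; exact: ext_next.
Qed.

Lemma retract_in x : C (retract x).
Proof.
apply: C_closed => n; have [c [Cc hc]] := ext_retract x n.
exists c; split => // i i_n; have := congr1 (fun l => nth 0%N l i) hc.
by rewrite size_mkseq !nth_mkseq.
Qed.

Lemma retract_id x : C x -> retract x = x.
Proof.
move=> Cx; apply/funext => n.
elim/ltn_ind: n => n IH; rewrite /retract /next; case: asboolP => // -[].
exists x; split => //; rewrite size_rcons prefixesE size_mkseq mkseqS.
congr rcons; apply/eq_in_map => i; rewrite mem_iota => /andP[_ i_n].
exact: IH.
Qed.

Lemma retract_agree x y n : agree n x y -> agree n (retract x) (retract y).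
Proof.
move=> xy.
suff h m : (m <= n)%N -> prefixes x m = prefixes y m.
  by move=> i i_n; rewrite /retract h ?xy// ltnW.
elim: m => //= m IH mn; rewrite IH ?xy//; exact: ltnW.
Qed.

End Retraction.

(** Composing [F] with the retraction onto [C] exhibits the image of [C] as the range of a
    continuous map on the whole Baire space. *)
Lemma analytic_image_closed (U : topologicalType) (C : set (nat -> nat))
    (F : baire_space -> U) :
  (forall x, (forall n, exists y, C y /\ agree n x y) -> C x) ->
  continuous F -> analytic_set [set F x | x in C].
Proof.
move=> Cc cF; have [->|/set0P[c0 Cc0]] := eqVneq C set0.
  by left; rewrite image_set0.
right; exists (F \o retract C c0); split.
  move=> x; apply: continuous_comp; last exact: cF.
  apply: (@finitary_continuous nat nat (retract C c0)) => {}x i.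
  by exists i.+1 => y /(retract_agree C c0); exact.
apply/seteqP; split => [_ [x _ <-]|_ [x Cx <-]].
  by exists (retract C c0 x) => //; exact: retract_in.
by exists x => //=; rewrite retract_id.
Qed.

End SequenceSpaces.

(** * Increasing sequences of integers and their ranges *)

Section Increasing.

Lemma increasing_ge (s : nat -> nat) : (forall n, (s n < s n.+1)%N) ->
  forall n, (n <= s n)%N.
Proof. by move=> hs; elim=> // n IH; exact: leq_ltn_trans IH (hs n). Qed.

Lemma increasing_lt (s : nat -> nat) : (forall n, (s n < s n.+1)%N) ->
  forall m n, (m < n)%N -> (s m < s n)%N.
Proof.
move=> hs m; elim=> // n IH; rewrite ltnS leq_eqVlt => /predU1P[->//|/IH h].
exact: ltn_trans h _.
Qed.

Lemma increasing_inj (s : nat -> nat) : (forall n, (s n < s n.+1)%N) -> injective s.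
Proof.
move=> hs m n; case: (ltngtP m n) => // /(increasing_lt hs); lia.
Qed.

(** For increasing [s] one has [i <= s i], so the search up to [k] is exhaustive. Bit [k] then
    depends on finitely many values of [s], whence continuity. *)
Definition range_indic (s : nat -> nat) : nat -> bool :=
  fun k => has (fun i => s i == k) (iota 0 k.+1).

Lemma range_indicP (s : nat -> nat) : (forall n, (s n < s n.+1)%N) ->
  enumerates (range_indic s) s.
Proof.
move=> hs; split => // k; split.
  by move=> /hasP[i _ /eqP]; exists i.
move=> [i ik]; apply/hasP; exists i; last exact/eqP.
by rewrite mem_iota /= add0n ltnS -ik increasing_ge.
Qed.

Lemma enumerates_indic (N : nat -> bool) s : enumerates N s -> N = range_indic s.
Proof.
move=> [hs hN]; apply/funext => k; apply/idP/idP.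
  by move=> /hN/(range_indicP hs).2.
by move=> /(range_indicP hs).2 /hN.
Qed.

Lemma enumerates_infinite (N : nat -> bool) s : enumerates N s -> infinite_omega N.
Proof.
move=> [hs hN] m; exists (s m); split; first exact: increasing_ge.
by apply/hN; exists m.
Qed.

End Increasing.

(** * Analyticity of permutative equivalence *)

Section PermEquivAnalytic.
Variables (R : realType) (V : completeNormedModType R) (u : nat -> V).

(** One point of the Baire space interleaves sequences by residues modulo 5; the residue 4 is used
    only through the single entry [z 4], a constant. *)
Definition strand (j : nat) (z : nat -> nat) : nat -> nat := fun k => z (5 * k + j)%N.

Lemma strand_agree j n (z z' : nat -> nat) : (j < 5)%N ->
  agree (5 * n) z z' -> agree n (strand j z) (strand j z').
Proof. by move=> j5 h i i_n; apply: h; lia. Qed.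

Lemma strands_exist (s0 s1 s2 s3 : nat -> nat) (K : nat) : exists z,
  [/\ strand 0 z = s0, strand 1 z = s1, strand 2 z = s2, strand 3 z = s3 & z 4 = K].
Proof.
pose z k := nth (fun=> K) [:: s0; s1; s2; s3] (k %% 5)%N (k %/ 5)%N.
exists z; split=> //; apply/funext => k; rewrite /strand /z;
  by rewrite mulnC modnMDl divnMDl//= addn0.
Qed.

(** The inverse [g] belongs to the witness so that bijectivity of [f] becomes a closed condition. *)
Definition perm_witness (z : nat -> nat) :=
  let s := strand 0 z in let t := strand 1 z in
  let f := strand 2 z in let g := strand 3 z in
  [/\ forall n, (s n < s n.+1)%N, forall n, (t n < t n.+1)%N,
    cancel f g /\ cancel g f,
    dominated (u \o s) (u \o t \o f) (z 4)%:R &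
    dominated (u \o t \o f) (u \o s) (z 4)%:R].

Lemma perm_witness_closed z :
  (forall n, exists z', perm_witness z' /\ agree n z z') -> perm_witness z.
Proof.
move=> h.
pose s := strand 0 z; pose t := strand 1 z.
pose f := strand 2 z; pose g := strand 3 z.
have hp n : exists z', [/\ perm_witness z', agree n s (strand 0 z'),
    agree n t (strand 1 z'), agree n f (strand 2 z') &
    agree n g (strand 3 z') /\ z 4 = z' 4].
  have [z' [Cz' zz']] := h (5 * n + 5)%N; exists z'.
  have zz5 : agree (5 * n) z z' by apply: agree_le zz'; lia.
  by split => //; try exact: strand_agree; split; [exact: strand_agree | apply: zz'; lia].
(* Agreement of [t \o f] on [n] entries requires agreement of [t] up to the largest of the first [n]
   values of [f]. *)
have ct n : exists z', [/\ perm_witness z', agree n s (strand 0 z'),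
    agree n (t \o f) (strand 1 z' \o strand 2 z') & z 4 = z' 4].
  have [z' [Cz' ss tt ff [gg KK]]] := hp (n + \max_(i < n) f i).+1.
  exists z'; split=> //; first by apply: agree_le ss; lia.
  move=> i i_n /=; rewrite -ff; last lia.
  apply: tt; rewrite ltnS (leq_trans _ (leq_addl _ _))//.
  exact: (leq_bigmax (Ordinal i_n)).
split.
- move=> n; have [z' [[hs _ _ _ _] ss _ _ _]] := hp n.+2.
  by move: (hs n); rewrite -!ss.
- move=> n; have [z' [[_ ht _ _ _] _ tt _ _]] := hp n.+2.
  by move: (ht n); rewrite -!tt.
- split=> n.
    have [z' [[_ _ [fg _] _ _] _ _ ff [gg _]]] := hp (n + f n).+1.
    by move: (fg n); rewrite -ff ?ltnS ?leq_addr// -gg// ltnS leq_addl.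
  have [z' [[_ _ [_ gf] _ _] _ _ ff [gg _]]] := hp (n + g n).+1.
  by move: (gf n); rewrite -gg ?ltnS ?leq_addr// -ff// ltnS leq_addl.
- move=> a n; have [z' [[_ _ _ d _] ss tf KK]] := ct n.
  move=> ha; rewrite KK; have := d a n.
  rewrite (_ : combo (u \o strand 1 z' \o strand 2 z') a n = combo (u \o t \o f) a n).
    apply=> k kn; rewrite (_ : combo _ a k = combo (u \o s) a k); first exact: ha.
    by apply: eq_bigr => i _; rewrite /= ss// (leq_trans _ kn).
  by apply: eq_bigr => i _ /=; have /= -> := tf i (ltn_ord i).
move=> a n; have [z' [[_ _ _ _ d] ss tf KK]] := ct n.
move=> ha; rewrite KK; have := d a n.
rewrite (_ : combo (u \o strand 0 z') a n = combo (u \o s) a n).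
  apply=> k kn; rewrite (_ : combo _ a k = combo (u \o t \o f) a k); first exact: ha.
  by apply: eq_bigr => i _ /=; have /= -> := tf i (leq_trans (ltn_ord i) kn).
by apply: eq_bigr => i _ /=; rewrite ss.
Qed.

(** By [seq_equivP], the relation is the image of the closed set [perm_witness] under the continuous
    map sending [z] to the ranges of its first two strands. *)
Lemma perm_equiv_analytic : basic_seq u ->
  analytic_set [set p : cantor_space * cantor_space |
    [/\ infinite_omega p.1, infinite_omega p.2 & ubs_perm_equiv u p.1 p.2]].
Proof.
move=> bu; have u0 := basic_seq_neq0 bu.
pose F (z : baire_space) : cantor_space * cantor_space :=
  (range_indic (strand 0 z), range_indic (strand 1 z)).
have strand_cont j : (j < 5)%N ->
    continuous (fun z : baire_space => range_indic (strand j z) : cantor_space).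
  move=> j5; apply: (@finitary_continuous nat bool
    (fun z => range_indic (strand j z))) => z k.
  exists (5 * k.+1)%N => z' /(strand_agree j5) zz'.
  apply: eq_in_has => i; rewrite mem_iota => /andP[_ ik].
  by rewrite zz'.
have cF : continuous F.
  move=> z; have FF : Filter (nbhs z) := nbhs_filter z.
  exact: (cvg_pair (strand_cont 0%N isT z) (strand_cont 1%N isT z)).
have := analytic_image_closed perm_witness_closed cF.
congr analytic_set; apply/seteqP; split => [_ [z Cz <-]|[N M] /=].
  have [hs ht [fg gf] d1 d2] := Cz.
  have es := range_indicP hs; have et := range_indicP ht.
  split; [exact: enumerates_infinite es|exact: enumerates_infinite et|].
  exists (strand 0 z), (strand 1 z); split => //.
  exists (strand 2 z); split; first by exists (strand 3 z).
  by apply/seq_equivP => //; [move=> i; exact: u0..|exists (z 4)].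
move=> [_ _ [s [t [es et [f [[g fg gf] /seq_equivP []]]]]]].
- by move=> i; exact: u0.
- by move=> i; exact: u0.
move=> K [d1 d2].
have [z [z0 z1 z2 z3 z4]] := strands_exist s t f g K.
exists z; last by rewrite /F z0 z1 (enumerates_indic es) (enumerates_indic et).
by rewrite /perm_witness z0 z1 z2 z3 z4; split => //; [exact: es.1|exact: et.1].
Qed.

End PermEquivAnalytic.

(** * The basis constant *)

Section BasisConstant.
Variables (R : realType) (V : completeNormedModType R).

Lemma half_expn_small (e : R) : 0 < e -> exists n : nat, 2^-1 ^+ n <= e.
Proof.
move=> e0; exists (Num.truncn e^-1).+1.
rewrite exprVn -[leRHS]invrK lef_pV2 ?posrE ?exprn_gt0 ?invr_gt0//.
have := truncnS_gt e^-1; move/ltW/le_trans; apply.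
by rewrite -natrX ler_nat ltnW// ltn_expl.
Qed.

(** Baire category theorem relative to [Y]: if no [A n] were dense in a ball of [Y], nested balls
    avoiding the sets [A n] one after another would shrink to a point of [Y] outside all of them. *)
Lemma closed_not_meager (Y : set V) (A : nat -> set V) : closed Y -> Y !=set0 ->
  Y `<=` \bigcup_n A n ->
  exists n y d, [/\ Y y, 0 < d & forall z, Y z -> `|z - y| <= d ->
    forall e : R, 0 < e -> exists2 a, A n a & `|z - a| <= e].
Proof.
move=> cY [y0 Yy0] YA; apply: contrapT => hN.
(* One step of the construction: inside the ball [(y, d)], a ball of at most half the radius,
   centred in [Y], whose centre is farther than its radius from every point of [A n]. *)
have /choice[st hst] (np : nat * (V * R)) : exists q : V * R,
    Y np.2.1 -> 0 < np.2.2 -> [/\ Y q.1, 0 < q.2, `|q.1 - np.2.1| + q.2 <= np.2.2,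
      q.2 <= np.2.2 / 2 & forall a, A np.1 a -> q.2 < `|q.1 - a|].
  case: np => n [y d] /=.
  have [[Yy d0]|nYd] := pselect (Y y /\ 0 < d); last first.
    by exists (y, d) => Yy d0; exfalso; apply: nYd.
  have [z [Yz zy [e e0 ze]]] : exists z, [/\ Y z, `|z - y| <= d / 2 &
      exists2 e : R, 0 < e & forall a, A n a -> e < `|z - a|].
    apply: contrapT => nz; apply: hN; exists n, y, (d / 2); split => //.
      by rewrite divr_gt0.
    move=> z Yz zy e e0; apply: contrapT => na; apply: nz; exists z; split => //.
    exists e => // a Aa; rewrite ltNge; apply/negP => zae; apply: na; by exists a.
  exists (z, Num.min e (d / 2)) => _ _ /=; split => //.
  - by rewrite lt_min e0 divr_gt0.
  - by rewrite [leRHS]splitr lerD// ge_min lexx orbT.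
  - by rewrite ge_min lexx orbT.
  - by move=> a /ze; apply: le_lt_trans; rewrite ge_min lexx.
pose B := fix B n := if n is m.+1 then st (m, B m) else (y0, 1 : R).
have BP n : Y (B n).1 /\ 0 < (B n).2.
  elim: n => [|n [h1 h2]]; first by split => //=; exact: ltr01.
  by have [] := hst (n, B n) h1 h2.
have BS n : [/\ `|(B n.+1).1 - (B n).1| + (B n.+1).2 <= (B n).2,
    (B n.+1).2 <= (B n).2 / 2 & forall a, A n a -> (B n.+1).2 < `|(B n.+1).1 - a|].
  by have [h1 h2] := BP n; have [] := hst (n, B n) h1 h2.
have Bnest m n : (m <= n)%N -> `|(B n).1 - (B m).1| + (B n).2 <= (B m).2.
  elim: n => [|n IH]; first by rewrite leqn0 => /eqP->; rewrite subrr normr0 add0r.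
  rewrite leq_eqVlt => /predU1P[->|]; first by rewrite subrr normr0 add0r.
  rewrite ltnS => /IH; apply: le_trans.
  have [h _ _] := BS n; rewrite -(subrKA (B n).1).
  rewrite (le_trans (lerD (ler_normD _ _) (lexx _)))//.
  by rewrite addrAC addrC lerD2l.
have Bclose m n : (m <= n)%N -> `|(B n).1 - (B m).1| <= (B m).2.
  by move=> mn; rewrite (le_trans _ (Bnest m n mn))// lerDl ltW// (BP n).2.
have Brad n : (B n).2 <= 2^-1 ^+ n.
  elim: n => [|n IH]; first by rewrite expr0.
  have [_ h _] := BS n; rewrite (le_trans h)// exprS mulrC ler_pM2l//.
have /cvg_ex[l Bl] : cvg ((fun n => (B n).1) @ \oo).
  apply: cauchy_cvg; apply: cauchy_exP => e e0.
  have e2 : 0 < e / 2 by rewrite divr_gt0.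
  have [n hn] := half_expn_small e2.
  exists (B n).1, n => // m /= nm; rewrite -ball_normE /= distrC.
  rewrite (le_lt_trans (Bclose _ _ nm))// (le_lt_trans (Brad n))//.
  by rewrite (le_lt_trans hn)// ltr_pdivrMr// mulr2n mulrDr mulr1 ltrDl.
have lB m : `|l - (B m).1| <= (B m).2.
  apply/ler_addgt0Pr => e e0; move/cvgrPdist_le: Bl => /(_ e e0)[N _ hNl].
  rewrite -(subrKA (B (maxn m N)).1) (le_trans (ler_normD _ _))// addrC lerD//.
    exact: Bclose (leq_maxl _ _).
  exact: hNl (leq_maxr _ _).
have Yl : Y l.
  rewrite (closure_id Y).1//.
  move=> D /Bl[N _ hD]; exists (B N).1; split; first exact: (BP N).1.
  by apply: hD => /=.
have [n _ An] := YA _ Yl.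
have [_ _ /(_ l An)] := BS n.
by rewrite ltNge distrC lB.
Qed.

Variable u : nat -> V.

Lemma lin_spanP y : lin_span u y <-> exists a n, y = combo u a n.
Proof. by split => [[n [a ->]]|[a [n ->]]]; [exists a, n|exists n, a]. Qed.

Lemma closure_spanP y : closure (lin_span u) y <->
  forall e : R, 0 < e -> exists a n, `|y - combo u a n| <= e.
Proof.
split=> [cy e e0|h].
  have [v [/lin_spanP[a [n ->]]]] := cy _ (nbhsx_ballx y e e0).
  by rewrite -ball_normE /= => h; exists a, n; exact: ltW.
move=> B /nbhs_ballP[e /= e0 eB].
have e2 : 0 < e / 2 by rewrite divr_gt0.
have [a [n han]] := h _ e2.
exists (combo u a n); split; first by apply/lin_spanP; exists a, n.
apply: eB; rewrite -ball_normE /=; apply: le_lt_trans han _.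
by rewrite ltr_pdivrMr// mulr2n mulrDr mulr1 ltrDl.
Qed.

Lemma combo0 n : combo u (fun=> 0) n = 0.
Proof. exact: combo_eq0. Qed.

Lemma comboD a b n : combo u (fun i => a i + b i) n = combo u a n + combo u b n.
Proof. by rewrite /combo -big_split/=; apply: eq_bigr => i _; rewrite scalerDl. Qed.

Lemma combo_stable a n k : (n <= k)%N -> combo u (cutoff 0 n a) k = combo u a n.
Proof. by move=> nk; rewrite combo_cutoff leq0n (minn_idPr nk) min0n minn0 /combo big_ord0 subr0. Qed.

Lemma combo_cutoff0 a n k : combo u (cutoff 0 n a) k = combo u a (minn k n).
Proof. by rewrite combo_cutoff leq0n min0n minn0 /combo big_ord0 subr0. Qed.

Lemma combo_sub_common a b m n : exists c N, combo u a m - combo u b n = combo u c N.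
Proof.
exists (fun i => cutoff 0 m a i + (- 1) * cutoff 0 n b i), (maxn m n).
by rewrite comboD comboZ !combo_stable ?leq_maxl ?leq_maxr// scaleN1r.
Qed.

Lemma closure_spanB y a n : closure (lin_span u) y ->
  closure (lin_span u) (y - combo u a n).
Proof.
move=> /closure_spanP h; apply/closure_spanP => e /h[b [m hb]].
have [c [N hc]] := combo_sub_common b a m n.
by exists c, N; rewrite -hc opprB addrA subrK.
Qed.

Lemma closure_spanZ c y : closure (lin_span u) y -> closure (lin_span u) (c *: y).
Proof.
move=> /closure_spanP h; apply/closure_spanP => e e0.
have c1 : 0 < `|c| + 1 by rewrite ltr_wpDl.
have [b [m hb]] := h (e / (`|c| + 1)) (divr_gt0 e0 c1).
exists (fun i => c * b i), m; rewrite comboZ -scalerBr normrZ.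
rewrite (le_trans (ler_wpM2l (normr_ge0 c) hb))// mulrCA ler_piMr ?(ltW e0)//.
by rewrite ler_pdivrMr// mul1r lerDl.
Qed.

Lemma closure_spanD y z : closure (lin_span u) y -> closure (lin_span u) z ->
  closure (lin_span u) (y + z).
Proof.
move=> /closure_spanP hy /closure_spanP hz; apply/closure_spanP => e e0.
have e2 : 0 < e / 2 by rewrite divr_gt0.
have [a [n ha]] := hy _ e2; have [b [m hb]] := hz _ e2.
have [c [N hc]] := combo_sub_common a (fun i => - 1 * b i) n m.
exists c, N; rewrite -hc comboZ scaleN1r opprK opprD addrACA [e]splitr.
by rewrite (le_trans (ler_normD _ _))// lerD.
Qed.

Hypothesis u_basic : basic_seq u.

Let Y := closure (lin_span u).

Let bounded_expansion (M : R) : set V :=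
  [set y | exists a, combo u a @ \oo --> y /\ forall k, `|combo u a k| <= M].

(* First half of the open mapping argument, for the map sending a coefficient sequence to its sum. *)
Let almost_open : exists C : R, 0 < C /\ forall z i, Y z -> `|z| <= 2^-1 ^+ i ->
  exists b n, `|z - combo u b n| <= 2^-1 ^+ i.+1 /\
    forall k, `|combo u (cutoff 0 n b) k| <= C * 2^-1 ^+ i.
Proof.
have Y0 : Y 0 by apply: subset_closure; apply/lin_spanP; exists (fun=> 0), 0%N; rewrite combo0.
(* Partial sums of a convergent expansion are bounded, so the sets [bounded_expansion n] cover the
   closed span and Baire's theorem applies. *)
have [|||M [y [d [Yy d0 hd]]]] := @closed_not_meager Y (fun n => bounded_expansion n%:R).
- exact: closed_closure.
- by exists 0.
- move=> y Yy; have [a [ha _]] := u_basic Yy; rewrite series_combo in ha.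
  have /cvg_seq_bounded[N [_ hN]] : cvg (combo u a @ \oo) by apply/cvg_ex; exists y.
  exists (Num.truncn (N + 1)).+1 => //; exists a; split => // k.
  apply: le_trans (hN (N + 1) _ k I) _; first by rewrite ltrDl.
  by apply: ltW; exact: truncnS_gt.
(* Both [y + z] and [y] lie in a ball where vectors with expansions bounded by [M] are dense; the
   difference of two such approximants approximates [z], with bound [2 * M]. *)
have approx_by z e : Y z -> `|z| <= d -> 0 < e ->
    exists b n, `|z - combo u b n| <= e /\
      forall k, `|combo u (cutoff 0 n b) k| <= 2 * M%:R.
  move=> Yz zd e0; have e4 : 0 < e / 4 by rewrite divr_gt0.
  have [|v2 [a2 [ca2 ba2]] h2] := hd (y + z) (closure_spanD Yy Yz) _ (e / 4) e4.
    by rewrite addrC addKr.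
  have [|v1 [a1 [ca1 ba1]] h1] := hd y Yy _ (e / 4) e4.
    by rewrite subrr normr0 ltW.
  move/cvgrPdist_le: ca1 => /(_ _ e4)[N1 _ hN1].
  move/cvgrPdist_le: ca2 => /(_ _ e4)[N2 _ hN2].
  have {hN1} k1 := hN1 _ (leq_maxl N1 N2); have {hN2} k2 := hN2 _ (leq_maxr N1 N2).
  set k := maxn N1 N2 in k1 k2; exists (fun i => a2 i + - 1 * a1 i), k; split.
    rewrite comboD comboZ scaleN1r.
    have -> : z - (combo u a2 k - combo u a1 k) =
        ((y + z - v2) + (v2 - combo u a2 k)) - ((y - v1) + (v1 - combo u a1 k)).
      rewrite !subrKA !opprB [y + z]addrC -!addrA; congr (_ + _).
      by rewrite [RHS]addrA [RHS]addrC subrKA.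
    have -> : e = (e / 4 + e / 4) + (e / 4 + e / 4) by lra.
    rewrite (le_trans (ler_normB _ _))// lerD// (le_trans (ler_normD _ _))// lerD//.
  move=> k'; rewrite combo_cutoff0 comboD comboZ scaleN1r.
  rewrite (le_trans (ler_normB _ _))// mulrDl mul1r lerD//.
exists ((2 * M%:R + 1) / d); split.
  by rewrite divr_gt0// ltr_wpDl// mulr_ge0.
(* Scaling by [c] carries the ball of radius 2^-i to the ball of radius [d]. *)
move=> z i Yz zi; pose c := d * 2 ^+ i.
have c0 : 0 < c by rewrite mulr_gt0// exprn_gt0.
have [||b [n [hb1 hb2]]] := approx_by (c *: z) (c * 2^-1 ^+ i.+1) (@closure_spanZ c _ Yz).
- rewrite normrZ gtr0_norm// -ler_pdivlMl// (le_trans zi)// /c invfM mulrAC.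
  by rewrite mulVf ?gt_eqF// mul1r exprVn.
- by rewrite mulr_gt0// exprn_gt0// invr_gt0.
exists (fun i => c^-1 * b i), n; split.
  rewrite comboZ -[z in leLHS](@scalerK _ _ c) ?gt_eqF// -scalerBr normrZ.
  by rewrite gtr0_norm ?invr_gt0// ler_pdivrMl.
move=> k; rewrite combo_cutoff0 comboZ -combo_cutoff0 normrZ gtr0_norm ?invr_gt0//.
rewrite (le_trans (ler_wpM2l _ (hb2 k))) ?invr_ge0 ?(ltW c0)//.
have -> : (2 * M%:R + 1) / d * 2^-1 ^+ i = c^-1 * (2 * M%:R + 1).
  by rewrite /c invfM exprVn; ring.
by rewrite ler_wpM2l ?invr_ge0 ?(ltW c0)// lerDl.
Qed.

(** Second half of the open mapping argument: successive corrections write [combo u a n] as a sum of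
    finite combinations whose partial sums are at most C * 2^-i. Their coefficients add up to an
    expansion of the same vector, which by uniqueness is [a] cut at [n]; the geometric series gives
    the bound [2 * C]. *)
Lemma basis_constant : exists C : R, 0 < C /\ forall a n k, (k <= n)%N ->
  `|combo u a n| <= 1 -> `|combo u a k| <= C.
Proof.
have [C [C0 hC]] := almost_open.
exists (2 * C); split; first by rewrite mulr_gt0.
move=> a n k kn an1.
have u0 := basic_seq_neq0 u_basic.
have /choice[st hst] (iz : nat * V) : exists bn : (nat -> R) * nat,
    Y iz.2 -> `|iz.2| <= 2^-1 ^+ iz.1 -> `|iz.2 - combo u bn.1 bn.2| <= 2^-1 ^+ iz.1.+1 /\
      forall k, `|combo u (cutoff 0 bn.2 bn.1) k| <= C * 2^-1 ^+ iz.1.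
  have [[Yz hz]|nz] := pselect (Y iz.2 /\ `|iz.2| <= 2^-1 ^+ iz.1).
    by have [b [m hb]] := hC _ _ Yz hz; exists (b, m).
  by exists (fun=> 0, 0%N) => h1 h2; exfalso; apply: nz.
(* [z i] is the remainder after [i] corrections, [b i] the coefficients of the next correction, cut
   at its length [m i]. *)
pose z := fix z i := if i is j.+1 then
    let bn := st (j, z j) in z j - combo u bn.1 bn.2
  else combo u a n.
pose b i := cutoff 0 (st (i, z i)).2 (st (i, z i)).1.
pose m i := (st (i, z i)).2.
have zP i : Y (z i) /\ `|z i| <= 2^-1 ^+ i.
  elim: i => [|i [h1 h2]].
    split; last by rewrite expr0.
    by apply: subset_closure; apply/lin_spanP; exists a, n.
  have [h3 _] := hst (i, z i) h1 h2.
  by split => //=; exact: closure_spanB.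
have bP i k' : `|combo u (b i) k'| <= C * 2^-1 ^+ i.
  by have [h1 h2] := zP i; have [_ h] := hst (i, z i) h1 h2; exact: h.
have zS i k' : (m i <= k')%N -> z i.+1 = z i - combo u (b i) k'.
  by move=> mk; rewrite /b combo_stable.
pose B I j := \sum_(i < I) b i j.
have BS I k' : combo u (B I.+1) k' = combo u (B I) k' + combo u (b I) k'.
  by rewrite -comboD; apply: eq_combo => j _; rewrite /B big_ord_recr.
have Bdist I J k' : (J <= I)%N ->
    `|combo u (B I) k' - combo u (B J) k'| <= 2 * C * (2^-1 ^+ J - 2^-1 ^+ I).
  elim: I => [|I IH]; first by rewrite leqn0 => /eqP->; rewrite !subrr normr0 mulr0.
  rewrite leq_eqVlt => /predU1P[->|]; first by rewrite !subrr normr0 mulr0.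
  rewrite ltnS => /IH h; rewrite BS addrAC (le_trans (ler_normD _ _))//.
  rewrite (le_trans (lerD h (bP I k')))// exprS; lra.
have Bz J k' : (forall i, (i < J)%N -> (m i <= k')%N) -> combo u (B J) k' = combo u a n - z J.
  elim: J => [|J IH] h.
    by rewrite /= subrr combo_eq0// => j _; rewrite /B big_ord0.
  rewrite BS IH; last by move=> i iJ; apply: h; exact: ltnW.
  by rewrite (zS J k') ?h// opprB addrA [in RHS]addrAC.
have Bcvg j : cvg ((fun I => B I j) @ \oo).
  have -> : (fun I => B I j) = series (fun i => b i j).
    by apply/funext => I; rewrite seriesE.
  apply/(@cvg_series_tailP R R) => e e0.
  have uj : 0 < `|u j| by rewrite normr_gt0.
  have [N hN] : exists N : nat, 2^-1 ^+ N <= e * `|u j| / (4 * C).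
    by apply: half_expn_small; rewrite divr_gt0 ?mulr_gt0.
  exists N => I NI; rewrite !seriesE -/(B I j) -/(B N j) -(ler_pM2r uj) -normrZ.
  have -> : (B I j - B N j) *: u j = (combo u (B I) j.+1 - combo u (B N) j.+1) -
      (combo u (B I) j - combo u (B N) j).
    by rewrite !comboS scalerBl opprD addrACA [RHS]addrC addKr.
  have small k' : `|combo u (B I) k' - combo u (B N) k'| <= 2 * C * 2^-1 ^+ N.
    rewrite (le_trans (Bdist _ _ _ NI))// ler_pM2l ?mulr_gt0//.
    by rewrite gerBl exprn_ge0.
  rewrite (le_trans (ler_normB _ _))// (le_trans (lerD (small _) (small _)))//.
  move: hN; rewrite ler_pdivlMr ?mulr_gt0//; lra.
pose c j := lim ((fun I => B I j) @ \oo).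
have Bc k' : (fun I => combo u (B I) k') @ \oo --> combo u c k'.
  elim: k' => [|k' IH].
    by rewrite /combo big_ord0; under eq_fun do rewrite big_ord0; exact: cvg_cst.
  under eq_fun do rewrite comboS; rewrite comboS.
  by apply: cvgD => //; apply: cvgZr_tmp; exact: Bcvg.
have cB J k' : `|combo u c k' - combo u (B J) k'| <= 2 * C * 2^-1 ^+ J.
  apply/ler_addgt0Pr => e e0; move/cvgrPdist_le: (Bc k') => /(_ e e0)[N _ hN].
  rewrite -(subrKA (combo u (B (maxn N J)) k')) (le_trans (ler_normD _ _))// addrC lerD//.
    rewrite (le_trans (Bdist _ _ _ (leq_maxr _ _)))// ler_pM2l ?mulr_gt0//.
    by rewrite gerBl exprn_ge0.
  exact: hN (leq_maxl _ _).
have ca : c = cutoff 0 n a.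
  have cl : Y (combo u a n) by apply: subset_closure; apply/lin_spanP; exists a, n.
  have [d [hd dU]] := u_basic cl.
  rewrite -[LHS]dU -?[RHS]dU//; rewrite series_combo; apply/cvgrPdist_le => e e0.
    by exists n => // k' /= nk; rewrite combo_stable// subrr normr0 ltW.
  have [J hJ] : exists J : nat, 2^-1 ^+ J <= e / (2 * C + 1).
    by apply: half_expn_small; rewrite divr_gt0// ltr_wpDl// mulr_ge0// ltW.
  exists (\max_(i < J) m i) => // k' /= mk.
  have := cB J k'; rewrite Bz; last first.
    by move=> i iJ; rewrite (leq_trans _ mk)// (leq_bigmax (Ordinal iJ)).
  have -> : combo u c k' - (combo u a n - z J) =
      - ((combo u a n - combo u c k') - z J) by rewrite !opprB addrCA.
  rewrite normrN => h; rewrite -(subrK (z J) (combo u a n - _)).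
  rewrite (le_trans (ler_normD _ _))// (le_trans (lerD h (zP J).2))//.
  rewrite -[X in _ + X]mul1r -mulrDl (le_trans (ler_wpM2l _ hJ))//.
    by rewrite addr_ge0// mulr_ge0// ltW.
  by rewrite mulrC divfK// gt_eqF// ltr_wpDl// mulr_ge0// ltW.
have := cB 0%N k; rewrite ca combo_cutoff0 (minn_idPl kn) expr0 mulr1.
by rewrite [combo u (B 0%N) k]combo_eq0 ?subr0// => j _; rewrite /B big_ord0.
Qed.

End BasisConstant.

(** * Bounded functions and solid norms *)

Section BoundedFunctions.
Variables (I : Type) (R : realType).

Definition bounded_functions : {pred (I -> R)} :=
  mem [set f : I -> R | exists M, forall i, `|f i| <= M].

Lemma bounded_functionsP (f : I -> R) :
  reflect (exists M, forall i, `|f i| <= M) (f \in bounded_functions).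
Proof. by apply: (iffP idP) => [/set_mem|h]; last exact: mem_set. Qed.

Lemma bounded_functions_submod : submod_closed bounded_functions.
Proof.
split; first by apply/bounded_functionsP; exists 0 => i; rewrite normr0.
move=> a f g /bounded_functionsP[M hM] /bounded_functionsP[N hN].
apply/bounded_functionsP; exists (`|a| * M + N) => i.
rewrite (le_trans (ler_normD _ _))// lerD//.
by rewrite [(a *: f) i]/(a * f i) normrM ler_wpM2l.
Qed.

HB.instance Definition _ := GRing.isSubmodClosed.Build _ _ bounded_functions
  bounded_functions_submod.

Record linfty := Linfty { linfty_fun :> I -> R; linftyP : linfty_fun \in bounded_functions }.
HB.instance Definition _ := [isSub for linfty_fun].
HB.instance Definition _ := [Choice of linfty by <:].
HB.instance Definition _ := [SubChoice_isSubLmodule of linfty by <:].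

(** The value 0 keeps the set nonempty when [I] is empty. *)
Definition linfty_norm (f : linfty) : R :=
  sup [set r | r = 0 \/ exists i, r = `|f i|].

Lemma linfty_norm_le (f : linfty) M :
  linfty_norm f <= M <-> 0 <= M /\ forall i, `|f i| <= M.
Proof.
have [N hN] := bounded_functionsP _ (linftyP f).
have hs : has_sup [set r | r = 0 \/ exists i, r = `|f i|].
  split; first by exists 0; left.
  exists `|N| => r [->//|[i ->]]; exact: le_trans (hN i) (ler_norm N).
split=> [h|[M0 hM]].
  split=> [|i]; apply: le_trans h; apply: sup_ubound; try exact: hs.2.
    by left.
  by right; exists i.
by apply: ge_sup; [exact: hs.1 | move=> r [->//|[i ->]]].
Qed.

Lemma linfty_norm_ge0 (f : linfty) : 0 <= linfty_norm f.
Proof. by have /linfty_norm_le[] := lexx (linfty_norm f). Qed.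

Lemma linfty_norm_ge (f : linfty) i : `|f i| <= linfty_norm f.
Proof. by have /linfty_norm_le[_] := lexx (linfty_norm f). Qed.

Lemma linfty_normD (f g : linfty) : linfty_norm (f + g) <= linfty_norm f + linfty_norm g.
Proof.
apply/linfty_norm_le; split; first by rewrite addr_ge0 ?linfty_norm_ge0.
move=> i; rewrite [(f + g) i]/(f i + g i) (le_trans (ler_normD _ _))//.
by rewrite lerD ?linfty_norm_ge.
Qed.

Lemma linfty_normZ_le a (f : linfty) : linfty_norm (a *: f) <= `|a| * linfty_norm f.
Proof.
apply/linfty_norm_le; split; first by rewrite mulr_ge0 ?linfty_norm_ge0.
by move=> i; rewrite [(a *: f) i]/(a * f i) normrM ler_wpM2l// linfty_norm_ge.
Qed.

Lemma linfty_normZ a (f : linfty) : linfty_norm (a *: f) = `|a| * linfty_norm f.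
Proof.
apply/eqP; rewrite eq_le linfty_normZ_le/=.
have [->|a0] := eqVneq a 0; first by rewrite normr0 mul0r linfty_norm_ge0.
rewrite -ler_pdivlMl ?normr_gt0//.
by rewrite -normfV -{1}(scalerK a0 f) linfty_normZ_le.
Qed.

Lemma linfty_norm_eq0 (f : linfty) : linfty_norm f = 0 -> f = 0.
Proof.
move=> f0; apply/val_inj/funext => i; apply/eqP.
by rewrite -normr_le0 -f0 linfty_norm_ge.
Qed.

HB.instance Definition _ :=
  Lmodule_isNormed.Build R linfty linfty_normD linfty_normZ linfty_norm_eq0.

Lemma linfty_complete (F : set_system linfty) : ProperFilter F -> cauchy F -> cvg F.
Proof.
move=> FF /cauchyP Fc.
have ev_cvg i : cvg ((fun f : linfty => f i) @ F).
  apply: cauchy_cvg; apply: cauchy_exP => e e0.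
  have [f Ff] := Fc e e0; exists (f i).
  suff : F [set g : linfty | ball (f i) e (g i)] by [].
  apply: filterS Ff => g.
  rewrite -!ball_normE /= => h; apply: le_lt_trans h.
  exact: (linfty_norm_ge (f - g) i).
pose g i := lim ((fun f : linfty => f i) @ F).
have gP f e i : F (ball f e) -> `|g i - f i| <= e.
  move=> Ff; apply/ler_addgt0Pr => d d0.
  have /cvgrPdist_le/(_ d d0) h := ev_cvg i.
  have [h' [/= h1 h2]] := filter_ex (filterI h Ff).
  rewrite -(subrKA (h' i)) [e + d]addrC (le_trans (ler_normD _ _))// lerD//.
  apply: ltW; rewrite -ball_normE /= in h2; rewrite distrC; apply: le_lt_trans h2.
  exact: (linfty_norm_ge (f - h') i).
have gb : g \in bounded_functions.
  have [f Ff] := Fc 1 ltr01; have [N hN] := bounded_functionsP _ (linftyP f).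
  apply/bounded_functionsP; exists (1 + N) => i.
  by rewrite -(subrK (f i) (g i)) (le_trans (ler_normD _ _))// lerD// gP.
apply/cvg_ex; exists (Linfty gb); apply/cvgrPdist_le => e e0.
have e2 : 0 < e / 2 by rewrite divr_gt0.
have [f Ff] := Fc _ e2.
apply: filterS (Ff) => h fh; apply/linfty_norm_le; split; first exact: ltW.
move=> i; suff : `|g i - h i| <= e by [].
rewrite -(subrKA (f i)) [e]splitr.
rewrite (le_trans (ler_normD _ _))// lerD ?gP//.
rewrite -ball_normE /= in fh; apply: ltW; apply: le_lt_trans fh.
exact: (linfty_norm_ge (f - h) i).
Qed.

HB.instance Definition _ := Uniform_isComplete.Build linfty linfty_complete.

End BoundedFunctions.

(** * Solid norms defined by a family of weights *)

Section SolidSequenceSpace.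
Variables (R : realType) (I : Type) (phi : I -> nat -> R).
Hypothesis phi_ge0 : forall i j, 0 <= phi i j.
Hypothesis phi_le1 : forall i j, phi i j <= 1.
Hypothesis phi_norming : forall j, exists i, phi i j = 1.

Lemma ler_sum_sub_uniq (F : nat -> R) (s t : seq nat) : (forall j, 0 <= F j) ->
  uniq s -> uniq t -> {subset s <= t} -> \sum_(j <- s) F j <= \sum_(j <- t) F j.
Proof.
move=> F0 us ut st; rewrite [leRHS](bigID (mem s))/= -[leLHS]addr0 lerD ?sumr_ge0//.
rewrite -[X in _ <= X]big_filter le_eqVlt; apply/orP; left; apply/eqP/perm_big/uniq_perm => //.
  exact: filter_uniq.
by move=> j; rewrite mem_filter; case: (boolP (j \in s)) => // /st ->.
Qed.

(** Closing the weights under domination adds all their sign changes and truncations, so the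
    supremum norm over the hull becomes the supremum over [i] of the sums of [phi i j * |a j|]. *)
Definition solid_hull :=
  {psi : nat -> R | exists i, forall j, `|psi j| <= phi i j}.

Lemma solid_hull_le1 (psi : solid_hull) j : `|sval psi j| <= 1.
Proof. by case: psi => psi [i h] /=; exact: le_trans (h j) (phi_le1 i j). Qed.

Lemma evaluation_bounded j : (fun psi : solid_hull => sval psi j) \in
  @bounded_functions solid_hull R.
Proof. by apply/bounded_functionsP; exists 1 => psi; exact: solid_hull_le1. Qed.

Definition solid_basis (j : nat) : linfty solid_hull R := Linfty (evaluation_bounded j).

Lemma combo_solidE (rho : nat -> nat) a n (psi : solid_hull) :
  combo (solid_basis \o rho) a n psi = \sum_(k < n) a k * sval psi (rho k).
Proof.
elim: n => [|n IH]; first by rewrite /combo !big_ord0.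
by rewrite comboS big_ord_recr/= -IH.
Qed.

Lemma solid_norm_le (rho : nat -> nat) a n M : injective rho -> 0 <= M ->
  `|combo (solid_basis \o rho) a n| <= M <->
  forall i, \sum_(k < n) phi i (rho k) * `|a k| <= M.
Proof.
move=> rho_inj M0; split=> [h i|h].
  (* The weight [phi i] with the signs of the coefficients; as [rho] is injective, the inner sum has
     at most one term. *)
  pose sg j := Num.sg (\sum_(k < n | rho k == j) a k) * phi i j.
  have hsg j : `|sg j| <= phi i j.
    rewrite normrM normr_sg ger0_norm//; case: (_ != 0); first by rewrite mul1r.
    by rewrite mul0r.
  pose psi : solid_hull := exist _ sg (ex_intro _ i hsg).
  have := linfty_norm_ge (combo (solid_basis \o rho) a n) psi.
  rewrite combo_solidE /= => /le_trans/(_ h); apply: le_trans.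
  rewrite ler_normr; apply/orP; left; rewrite ler_sum// => k _.
  rewrite /sg (big_pred1 k) => [|k' /=].
    by rewrite mulrA [a k * _]mulrC -normrEsg mulrC.
  by apply/eqP/eqP => [/rho_inj/val_inj//|->].
apply/linfty_norm_le; split => // -[psi [i hpsi]].
rewrite combo_solidE/= (le_trans (ler_norm_sum _ _ _))//.
apply: le_trans (h i); rewrite ler_sum// => k _.
by rewrite normrM mulrC ler_wpM2r.
Qed.

Lemma solid_cvgP (rho : nat -> nat) a : injective rho ->
  cvg (series (fun k => a k *: solid_basis (rho k)) @ \oo) <->
  forall e : R, 0 < e -> exists N, forall n i, (N <= n)%N ->
    \sum_(N <= k < n) phi i (rho k) * `|a k| <= e.
Proof.
move=> rho_inj.
have tail N n (e : R) : (N <= n)%N -> 0 < e ->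
    `|series (fun k => a k *: solid_basis (rho k)) n -
      series (fun k => a k *: solid_basis (rho k)) N| <= e <->
    forall i, \sum_(N <= k < n) phi i (rho k) * `|a k| <= e.
  move=> Nn e0; rewrite (series_combo (solid_basis \o rho)).
  have := combo_cutoff (solid_basis \o rho) N n a n.
  rewrite Nn minnn (minn_idPl Nn) (minn_idPr Nn) => <-.
  have E i : \sum_(N <= k < n) phi i (rho k) * `|a k| =
     \sum_(k < n) phi i (rho k) * `|cutoff N n a k|.
    rewrite -(big_mkord xpredT (fun k => phi i (rho k) * `|cutoff N n a k|)).
    rewrite [RHS](@big_cat_nat _ _ _ N)//= [X in _ = X + _]big1_seq ?add0r.
      by apply: eq_big_nat => k kn; rewrite /cutoff kn.
    move=> k /andP[_]; rewrite mem_index_iota => /andP[_ kN].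
    by rewrite /cutoff leqNgt kN/= normr0 mulr0.
  have -> := solid_norm_le (cutoff N n a) n rho_inj (ltW e0).
  by split=> h i; [rewrite E|rewrite -E].
split=> [/cvg_series_tailP h e e0|h].
  have [N hN] := h e e0; exists N => n i Nn.
  have Q := (tail N n e Nn e0).1 (hN n Nn); exact: Q.
apply/cvg_series_tailP => e e0; have [N hN] := h e e0; exists N => n Nn.
exact: ((tail N n e Nn e0).2 (fun i => hN n i Nn)).
Qed.

Lemma span_solidE n (a : nat -> R) (psi : solid_hull) :
  (\sum_(k < n) a k *: solid_basis k) psi = \sum_(k < n) a k * sval psi k.
Proof. by have := combo_solidE id a n psi. Qed.

Let delta_le j : exists i, forall k, `|(k == j)%:R : R| <= phi i k.
Proof.
have [i hi] := phi_norming j; exists i => k.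
by case: eqP => [->|_]; rewrite ?hi ?normr1 ?normr0.
Qed.
Let delta j : solid_hull := exist _ (fun k => (k == j)%:R) (delta_le j).

Let trunc_le m (psi : solid_hull) :
  exists i, forall k, `|if (k < m)%N then sval psi k else 0| <= phi i k.
Proof.
case: psi => psi [i hi]; exists i => k /=.
by case: ifP; rewrite ?normr0.
Qed.
Let trunc m psi : solid_hull := exist _ _ (trunc_le m psi).

(** [delta k] reads off the [k]-th coefficient, so evaluating at the truncation of [psi] amounts to
    evaluating the [m]-th partial sum at [psi]. *)
Let trunc_span m psi (v : linfty solid_hull R) : lin_span solid_basis v ->
  v (trunc m psi) = \sum_(k < m) v (delta k) * sval psi k.
Proof.
move=> [n [b ->]]; rewrite span_solidE /=.
under [RHS]eq_bigr => k _.
  rewrite span_solidE /= (_ : \sum_(_ < _) _ = if (k < n)%N then b k else 0).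
    over.
  case: ifPn => kn.
    rewrite (bigD1 (Ordinal kn))//= eqxx mulr1 big1 ?addr0// => i ik.
    rewrite (_ : (i == k :> nat) = false) ?mulr0//; apply/negP => /eqP h.
    by move/eqP: ik; apply; exact: val_inj.
  rewrite big1// => i _; rewrite (_ : (i == k :> nat) = false) ?mulr0//.
  by apply/eqP => ik; move: kn; rewrite -ik ltn_ord.
pose N := (maxn m n).
rewrite (big_ord_widen_cond N xpredT (fun k => b k * if (k < m)%N then sval psi k else 0)) ?leq_maxr//.
rewrite (big_ord_widen_cond N xpredT (fun k => (if (k < n)%N then b k else 0) * sval psi k)) ?leq_maxl//.
rewrite big_mkcond [RHS]big_mkcond; apply: eq_bigr => k _ /=.
by case: (k < n)%N; case: (k < m)%N; rewrite ?mul0r ?mulr0.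
Qed.

Let closure_approx (y : linfty solid_hull R) e : closure (lin_span solid_basis) y ->
  0 < e -> exists2 v, lin_span solid_basis v & forall psi, `|y psi - v psi| <= e.
Proof.
move=> cy e0; have [v [sv]] := cy _ (nbhsx_ballx y e e0).
rewrite -ball_normE /= => h; exists v => // psi.
apply: ltW; apply: le_lt_trans h; exact: (linfty_norm_ge (y - v) psi).
Qed.

Let trunc_closure m psi (y : linfty solid_hull R) : closure (lin_span solid_basis) y ->
  y (trunc m psi) = \sum_(k < m) y (delta k) * sval psi k.
Proof.
move=> cy; apply/eqP; rewrite -subr_eq0 -normr_le0; apply/ler_addgt0Pr => e e0.
(* There are [m + 1] errors: one at the truncation, and one for each of the [m] coordinates,
   weighted by values of modulus at most 1. *)
have e1 : 0 < e / (m%:R + 1) by rewrite divr_gt0// ltr_wpDl.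
have [v sv yv] := closure_approx cy e1.
rewrite add0r -(subrKA (v (trunc m psi))) (trunc_span _ _ sv) (le_trans (ler_normD _ _))//.
rewrite -sumrB; have -> : e = e / (m%:R + 1) + m%:R * (e / (m%:R + 1)).
  by rewrite addrC -[X in _ + X]mul1r -mulrDl mulrCA divff ?mulr1// gt_eqF// ltr_wpDl.
rewrite lerD//; first by rewrite -(trunc_span _ _ sv).
rewrite (le_trans (ler_norm_sum _ _ _))//.
rewrite -[m in m%:R * _]card_ord -sum1_card natr_sum mulr_suml ler_sum// => k _.
rewrite mul1r -mulrBl normrM distrC -[leRHS]mulr1 ler_pM//.
exact: solid_hull_le1.
Qed.

(** The coefficients of [y] are its values at [delta j]. Its partial sums are [y] evaluated at
    truncations, and converge uniformly because an approximant in the span is unaffected by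
    truncation beyond its length. *)
Lemma solid_basis_basic : basic_seq solid_basis.
Proof.
move=> y cy; exists (fun j => y (delta j)); split.
  apply/cvgrPdist_le => e e0; have e2 : 0 < e / 2 by rewrite divr_gt0.
  have [v [n [b vE]] yv] := closure_approx cy e2.
  exists n => // m /= nm; rewrite series_combo.
  apply/linfty_norm_le; split; first exact: ltW.
  move=> psi; suff : `|y psi - combo solid_basis (fun j => y (delta j)) m psi| <= e by [].
  rewrite (combo_solidE id) -(trunc_closure m psi cy).
  rewrite -(subrKA (v psi)) [e]splitr (le_trans (ler_normD _ _))// lerD//.
  have -> : v psi = v (trunc m psi).
    rewrite vE !span_solidE; apply: eq_bigr => k _ /=.
    by rewrite (leq_trans (ltn_ord k) nm).
  by rewrite distrC.
move=> a ha; apply/funext => j; apply/eqP; rewrite -subr_eq0 -normr_le0.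
apply/ler_addgt0Pr => e e0; rewrite add0r.
have /cvgrPdist_le/(_ e e0)[N _ /(_ (maxn N j.+1)) h] := ha.
have {h} := h (leq_maxl _ _); rewrite series_combo.
move=> /(le_trans (linfty_norm_ge (y - _) (delta j))).
have -> : (y - combo solid_basis a (maxn N j.+1)) (delta j) =
   y (delta j) - combo solid_basis a (maxn N j.+1) (delta j) by [].
rewrite (combo_solidE id)/=.
have jN : (j < maxn N j.+1)%N by rewrite leq_max leqnn orbT.
rewrite (bigD1 (Ordinal jN))//= eqxx mulr1 big1 ?addr0// => i ij.
rewrite (_ : (i == j :> nat) = false) ?mulr0//; apply/negP => /eqP h.
by move/eqP: ij; apply; exact: val_inj.
Qed.

(** By [solid_cvgP], convergence means uniformly small tails of nonnegative sums, which a
    permutation merely rearranges. *)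
Lemma solid_basis_unconditional : unconditional_basic_seq solid_basis.
Proof.
split; first exact: solid_basis_basic.
move=> a /(@solid_cvgP id a (@inj_id _)) ca p bp.
have pinj := bij_inj bp; have [g pg gp] := bp.
apply/(@solid_cvgP p (a \o p) pinj) => e e0.
have [N hN] := ca e e0.
(* From this index on, [p k] is at least [N]. *)
exists (\max_(j < N) (g j).+1) => n i nn.
apply: le_trans (hN (maxn N (\max_(k < n) (p k).+1)) i (leq_maxl _ _)).
rewrite -(big_map p xpredT (fun j => phi i j * `|a j|)).
apply: ler_sum_sub_uniq.
- by move=> j; rewrite mulr_ge0.
- by rewrite map_inj_uniq// iota_uniq.
- exact: iota_uniq.
move=> _ /mapP[k + ->]; rewrite !mem_index_iota => /andP[k1 k2].
apply/andP; split; last first.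
  by rewrite leq_max (leq_bigmax (Ordinal k2)) orbT.
rewrite leqNgt; apply/negP => pN; move: k1.
rewrite leqNgt => /negP; apply; have := leq_bigmax (Ordinal pN) (F := fun j : 'I_N => (g j).+1).
by rewrite /= pg.
Qed.

(** Domination is tested on the indicator of [G] divided by [B]. *)
Lemma solid_dominated_sum (rho rho' : nat -> nat) K (G : seq nat) (B : R) :
  injective rho -> injective rho' -> 0 <= K ->
  dominated (solid_basis \o rho) (solid_basis \o rho') K -> uniq G -> 0 < B ->
  (forall i, \sum_(k <- G) phi i (rho k) <= B) ->
  forall i, \sum_(k <- G) phi i (rho' k) <= K * B.
Proof.
move=> irho irho' K0 dom uG B0 hB i.
pose a k := if k \in G then B^-1 else 0.
have aE (F : nat -> R) m : \sum_(k < m) F k * `|a k| = B^-1 * \sum_(k <- iota 0 m | k \in G) F k.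
  rewrite mulr_sumr [RHS]big_mkcond/=.
  rewrite -(big_mkord xpredT (fun k => F k * `|a k|)) /index_iota subn0.
  apply: eq_bigr => k _; rewrite /a; case: ifP => _; last by rewrite normr0 mulr0.
  by rewrite ger0_norm ?invr_ge0 1?mulrC// ltW.
pose n := (\max_(k <- G) k).+1.
have h1 : forall k, (k <= n)%N -> `|combo (solid_basis \o rho) a k| <= 1.
  move=> k _; apply: (solid_norm_le a k irho ler01).2 => i'.
  rewrite (aE (fun k => phi i' (rho k))) -ler_pdivlMl ?invr_gt0// invrK mulr1; apply: le_trans (hB i').
  rewrite -big_filter; apply: ler_sum_sub_uniq => //.
    by rewrite filter_uniq// iota_uniq.
  by move=> j; rewrite mem_filter => /andP[].
have := (solid_norm_le a n irho' K0).1 (dom a n h1) i.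
rewrite (aE (fun k => phi i (rho' k))) mulrC ler_pdivrMr//; apply: le_trans.
rewrite -[leRHS]big_filter; apply: ler_sum_sub_uniq => //.
  by rewrite filter_uniq// iota_uniq.
move=> j jG; rewrite mem_filter jG mem_iota /= add0n ltnS.
exact: (leq_bigmax_seq _ jG).
Qed.

End SolidSequenceSpace.

(** * Transfer of an equivalence along injections *)

Section Transfer.
Variable R : realType.

Lemma series_sparse (V : completeNormedModType R) (v : nat -> V) (rho : nat -> nat) :
  (forall n, (rho n < rho n.+1)%N) ->
  (forall k, ~ (exists n, rho n = k) -> v k = 0) ->
  cvg (series v @ \oo) <-> cvg (series (v \o rho) @ \oo).
Proof.
move=> hr v0.
have seriesS (z : nat -> V) n : series z n.+1 = series z n + z n.
  by rewrite !seriesE big_ord_recr.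
have ri := increasing_inj hr.
(* [n] is the number of values of [rho] below [m]. *)
have cnt m : exists n, series v m = series (v \o rho) n /\
    forall i, (rho i < m)%N = (i < n)%N.
  elim: m => [|m [n [hn hi]]]; first by exists 0%N; rewrite !seriesE !big_ord0.
  have [rn|rn] := eqVneq (rho n) m.
    exists n.+1; split; first by rewrite !seriesS hn /= rn.
    by move=> i; rewrite ltnS leq_eqVlt hi [RHS]ltnS [RHS]leq_eqVlt -rn (inj_eq ri).
  have nm i : rho i <> m.
    move=> im; have := hi i; rewrite im ltnn => /esym/negbT; rewrite -leqNgt leq_eqVlt.
    case/predU1P => [ni|/(increasing_lt hr)]; first by move: rn; rewrite ni im eqxx.
    by rewrite im hi ltnn.
  exists n; split.
    by rewrite seriesS hn v0 ?addr0// => -[i]; exact: nm.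
  move=> i; rewrite ltnS leq_eqVlt hi; case: eqP => // /nm.
  by [].
have at_rho n : series v (rho n) = series (v \o rho) n.
  have [n' [h hi]] := cnt (rho n); rewrite h; suff -> : n' = n by [].
  case: (ltngtP n' n) => // nn; first by have := increasing_lt hr nn; rewrite hi ltnn.
  by move: nn; rewrite -hi ltnn.
have tv := cvg_series_tailP v; have tvr := cvg_series_tailP (v \o rho).
clear seriesS; move: tv tvr cnt at_rho.
move: (series v) (series (v \o rho)) => S T tv tvr cnt at_rho.
split=> [/tv h|/tvr h].
  apply/tvr => e e0; have e2 : 0 < e / 2 by rewrite divr_gt0.
  have [N hN] := h _ e2; exists N => n Nn.
  have Nr k : (N <= k)%N -> (N <= rho k)%N.
    by move=> Nk; rewrite (leq_trans Nk)// increasing_ge.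
  rewrite -(at_rho n) -(at_rho N) -(subrKA (S N)) [e]splitr (le_trans (ler_normD _ _))//.
  by rewrite lerD// ?[`|S N - _|]distrC hN// Nr.
apply/tv => e e0; have [N hN] := h _ e0; exists (rho N) => m Nm.
have [n [-> hi]] := cnt m; rewrite at_rho; apply: hN.
rewrite leqNgt; apply/negP => nN.
have : (rho n < m)%N by rewrite (leq_trans _ Nm)// increasing_lt.
by rewrite hi ltnn.
Qed.

Lemma injective_unbounded (tau : nat -> nat) : injective tau ->
  forall N, exists M, forall i, (M <= i)%N -> (N <= tau i)%N.
Proof.
move=> ti; elim=> [|N [M hM]]; first by exists 0%N.
have [[k hk]|nk] := pselect (exists k, tau k = N).
  exists (maxn M k.+1) => i; rewrite geq_max => /andP[/hM]; rewrite leq_eqVlt.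
  case/predU1P => [Ni|//]; rewrite -hk in Ni; by rewrite (ti _ _ Ni) ltnn.
exists M => i /hM; rewrite leq_eqVlt => /predU1P[Ni|//].
by exfalso; apply: nk; exists i.
Qed.

Definition push (tau : nat -> nat) (c : nat -> R) (m j : nat) : R :=
  \sum_(i < m | tau i == j) c i.

Lemma combo_push (V : lmodType R) (z : nat -> V) tau c m N :
  (forall i, (i < m)%N -> (tau i < N)%N) ->
  combo (z \o tau) c m = combo z (push tau c m) N.
Proof.
move=> tN; rewrite /combo /push.
under [RHS]eq_bigr do rewrite scaler_suml.
rewrite (exchange_big_dep xpredT)//=; apply: eq_bigr => i _.
by rewrite (big_pred1 (Ordinal (tN i (ltn_ord i)))).
Qed.

Lemma push_injective tau c m i : injective tau -> (i < m)%N -> push tau c m (tau i) = c i.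
Proof.
move=> ti im; rewrite /push (big_pred1 (Ordinal im))// => j /=.
by rewrite (inj_eq ti) -val_eqE.
Qed.

Lemma push_out tau c m j : ~ (exists i, tau i = j) -> push tau c m j = 0.
Proof. by move=> nj; rewrite /push big_pred0// => i; apply/negP => /eqP ij; apply: nj; exists i. Qed.

Lemma push_bound tau m : exists N, forall i, (i < m)%N -> (tau i < N)%N.
Proof.
exists (\max_(i < m) (tau i).+1) => i im.
exact: (leq_bigmax (F := fun i : 'I_m => (tau i).+1) (Ordinal im)).
Qed.

(** The sum [y] taken in the order of [tau] lies in the closed span, so it has an expansion [b] in
    the natural order. The basis constant makes coordinates continuous, which forces [b] to be
    [a]. *)
Lemma injective_series_extension (V : completeNormedModType R) (u : nat -> V)
    (tau : nat -> nat) (c a : nat -> R) : basic_seq u -> injective tau ->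
  (forall i, a (tau i) = c i) -> (forall k, ~ (exists i, tau i = k) -> a k = 0) ->
  cvg (series (fun i => c i *: u (tau i)) @ \oo) ->
  cvg (series (fun k => a k *: u k) @ \oo).
Proof.
move=> bu ti ac a0; rewrite (series_combo (u \o tau)) => /cvg_ex[y hy].
have [C [C0 hC]] := basis_constant bu.
have cy : closure (lin_span u) y.
  apply/closure_spanP => e e0; move/cvgrPdist_le: hy => /(_ e e0)[m _ hm].
  have [N hN] := push_bound tau m.
  by exists (push tau c m), N; rewrite -combo_push// hm//=.
have [b [hb _]] := bu y cy.
suff -> : a = b by apply/cvg_ex; exists y.
apply/funext => j; apply/eqP; rewrite -subr_eq0 -normr_le0.
have uj : 0 < `|u j| by rewrite normr_gt0 (basic_seq_neq0 bu).
rewrite -(pmulr_lle0 _ uj) -normrZ; apply/ler_addgt0Pr => e e0; rewrite add0r.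
pose d := e / (4 * C); have d0 : 0 < d by rewrite divr_gt0// mulr_gt0.
have d20 : 0 < (2 * d)^-1 by rewrite invr_gt0 mulr_gt0.
have [M hM] : exists M, forall m, (M <= m)%N -> push tau c m j = a j.
  have [[i hi]|nj] := pselect (exists i, tau i = j).
    by exists i.+1 => m im; rewrite -hi push_injective.
  by exists 0%N => m _; rewrite push_out// a0.
move/cvgrPdist_le: hy => /(_ _ d0)[M1 _ hM1].
pose m := maxn M M1.
rewrite series_combo in hb; move/cvgrPdist_le: hb => /(_ _ d0)[N1 _ hN1].
have [N2 hN2] := push_bound tau m.
pose N := maxn (maxn N1 N2) j.+1.
have hN i : (i < m)%N -> (tau i < N)%N.
  by move=> im; rewrite (leq_trans (hN2 _ im))// /N; lia.
(* Up to length [N], both combinations are within [d] of [y], so [D] sums to a vector of norm at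
   most 1; its [j]-th term is a difference of two partial sums bounded by [C], and
   [4 * C * d = e]. *)
pose D i := (2 * d)^-1 * (push tau c m i + (- 1) * b i).
have DE k : combo u D k = (2 * d)^-1 *: (combo u (push tau c m) k - combo u b k).
  by rewrite comboZ comboD comboZ scaleN1r.
have D1 : `|combo u D N| <= 1.
  rewrite DE -combo_push// normrZ gtr0_norm// ler_pdivrMl; last by rewrite mulr_gt0.
  rewrite mulr1 mulr_natl mulr2n.
  rewrite -(subrKA y) (le_trans (ler_normD _ _))// lerD//.
    by rewrite distrC hM1//= leq_maxr.
  by apply: hN1 => /=; rewrite /N; lia.
have h1 : `|combo u D j.+1| <= C by apply: hC D1; rewrite /N; lia.
have h2 : `|combo u D j| <= C by apply: hC D1; rewrite /N; lia.
have -> : (a j - b j) *: u j = (2 * d) *: (combo u D j.+1 - combo u D j).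
  rewrite (_ : combo u D j.+1 - combo u D j = D j *: u j); last first.
    by rewrite comboS addrC addKr.
  rewrite /D hM ?leq_maxl// mulN1r scalerA mulrA divff ?mul1r//.
  by rewrite gt_eqF// mulr_gt0.
have dd0 : 0 < 2 * d by exact: mulr_gt0.
rewrite normrZ gtr0_norm//.
rewrite (le_trans (ler_wpM2l _ (le_trans (ler_normB _ _) (lerD h1 h2))))//.
  exact: ltW.
rewrite le_eqVlt; apply/orP; left; apply/eqP; rewrite /d; field.
by rewrite gt_eqF.
Qed.

Section Solid.
Variables (I : Type) (phi : I -> nat -> R).
Hypothesis phi_ge0 : forall i j, 0 <= phi i j.
Hypothesis phi_le1 : forall i j, phi i j <= 1.
Hypothesis phi_norming : forall j, exists i, phi i j = 1.

Let w := @solid_basis R I phi phi_le1.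

(** The norm of [w] ignores the order of the vectors, so bounded sums along [tau] have bounded
    partial sums in the natural order, where domination applies. Conversely, a series in
    [u \o s \o tau] is first put in natural order by [injective_series_extension], and the solid
    criterion allows reordering once back in [w]. *)
Lemma solid_transfer (V : completeNormedModType R) (u : nat -> V) (s tau : nat -> nat) :
  basic_seq u -> (forall n, (s n < s n.+1)%N) -> seq_equiv w (u \o s) -> injective tau ->
  seq_equiv (w \o tau) (u \o s \o tau).
Proof.
move=> bu hs ws ti c.
have w0 : forall j, w j != 0.
  by apply: basic_seq_neq0; exact: solid_basis_basic.
split.
  have [K dom] := series_implies_dominated w0 (fun a => (ws a).1).
  apply: (@dominated_cvg R _ _ (w \o tau) (u \o s \o tau) K%:R) => a n ha.
  have [N hN] := push_bound tau n.
  rewrite (combo_push (u \o s) a hN); apply: dom => k _.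
  have := ha n (leqnn n).
  move=> /(solid_norm_le phi_ge0 phi_le1 a n ti ler01) hphi.
  apply: (solid_norm_le phi_ge0 phi_le1 (push tau a n) k (@inj_id _) ler01).2 => i.
  apply: le_trans (hphi i).
  apply: (@le_trans _ _ (\sum_(j < k) \sum_(l < n | tau l == j) phi i (tau l) * `|a l|)).
    apply: ler_sum => j _; rewrite /push.
    rewrite (le_trans (ler_wpM2l _ (ler_norm_sum _ _ _)))// mulr_sumr ler_sum//.
    by move=> l /eqP ->.
  rewrite (exchange_big_dep xpredT)//=; apply: ler_sum => l _.
  have [tk|kt] := ltnP (tau l) k.
    by rewrite (big_pred1 (Ordinal tk)).
  rewrite big_pred0 ?mulr_ge0// => j; apply/negP => /eqP tj.
  by move: kt; rewrite tj leqNgt ltn_ord.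
have sti : injective (s \o tau) by apply: inj_comp ti; exact: increasing_inj.
have /choice[a ha] k : exists x, (forall i, s (tau i) = k -> x = c i) /\
    (~ (exists i, s (tau i) = k) -> x = 0).
  have [[i hi]|ni] := pselect (exists i, s (tau i) = k).
    exists (c i); split=> [i'|]; last by move=> h; exfalso; apply: h; exists i.
    by rewrite -hi => /sti ->.
  by exists 0; split => // i hi; exfalso; apply: ni; exists i.
have a_tau i : a (s (tau i)) = c i by apply: (ha _).1.
move=> /(injective_series_extension bu sti a_tau (fun k => (ha k).2)).
move=> ca.
have off k : ~ (exists n, s n = k) -> a k *: u k = 0.
  by move=> nk; rewrite (ha k).2 ?scale0r// => -[i hi]; apply: nk; exists (tau i).
have cs := (series_sparse hs off).1 ca.
have {}cs := (ws (a \o s)).2 cs.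
move/(@solid_cvgP R I phi phi_ge0 phi_le1 id (a \o s) (@inj_id _)) : cs => cs.
apply/(@solid_cvgP R I phi phi_ge0 phi_le1 tau c ti) => e e0.
have [N hN] := cs e e0; have [M hM] := injective_unbounded ti N.
exists M => n i Mn; have [N' hN'] := push_bound tau n.
apply: le_trans (hN (maxn N N') i (leq_maxl _ _)).
rewrite (eq_bigr (fun k => phi i (tau k) * `|a (s (tau k))|)); last first.
  by move=> k _; rewrite a_tau.
rewrite -(big_map tau xpredT (fun j => phi i j * `|a (s j)|)).
apply: ler_sum_sub_uniq.
- by move=> j; rewrite mulr_ge0.
- by rewrite map_inj_uniq// iota_uniq.
- exact: iota_uniq.
move=> _ /mapP[k + ->]; rewrite !mem_index_iota => /andP[k1 k2].
by rewrite hM//= leq_max hN' ?orbT.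
Qed.

End Solid.
End Transfer.

(** * Ramsey's theorem and the Cantor-Bernstein theorem *)

Section Ultrafilter.

Lemma free_ultrafilter : exists U : set_system nat,
  UltraFilter U /\ forall n, U [set k | (n <= k)%N].
Proof.
have [U [UU sub]] := @ultraFilterLemma nat \oo _.
by exists U; split => // n; apply: sub; exists n.
Qed.

Lemma ultra_bounded_const (U : set_system nat) (g : nat -> nat) B : UltraFilter U ->
  U [set n | (g n <= B)%N] -> exists2 v, (v <= B)%N & U [set n | g n = v].
Proof.
move=> UU; elim: B => [|B IH] h.
  by exists 0%N => //; apply: filterS h => n /=; rewrite leqn0 => /eqP.
have [h1|h1] := in_ultra_setVsetC [set n | g n = B.+1] UU.
  by exists B.+1.
have [|v vB hv] := IH; last by exists v => //; exact: leqW.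
apply: filterS (filterI h h1) => n [/= ]; rewrite leq_eqVlt => /predU1P[->//|].
by rewrite ltnS.
Qed.

Lemma ultra_bool_const (U : set_system nat) (g : nat -> bool) : UltraFilter U ->
  exists v, U [set n | g n = v].
Proof.
move=> UU; have [h|h] := in_ultra_setVsetC [set n | g n = true] UU; first by exists true.
by exists false; apply: filterS h => n /=; case: (g n).
Qed.

Lemma ultra_agree (U : set_system nat) (T : Type) (g : nat -> nat -> T) (v : nat -> T) m :
  UltraFilter U -> (forall i, (i < m)%N -> U [set n | g n i = v i]) ->
  U [set n | agree m (g n) v].
Proof.
move=> UU; elim: m => [|m IH] h; first by apply: filterS filterT.
apply: filterS (filterI (IH _) (h m (ltnSn m))); last by move=> i im; exact: h (ltnW im).
by move=> n [h1 h2] i; rewrite ltnS leq_eqVlt => /predU1P[->//|/h1].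
Qed.

(** A free ultrafilter selects the colour: almost every [i] has that colour with almost every [j].
    The sequence is then chosen greedily. *)
Lemma ramsey_pairs (E : nat -> nat -> Prop) : exists e : nat -> nat,
  (forall m n, (m < n)%N -> (e m < e n)%N) /\
  ((forall m n, (m < n)%N -> E (e m) (e n)) \/
   (forall m n, (m < n)%N -> ~ E (e m) (e n))).
Proof.
have [U [UU Uge]] := free_ultrafilter.
suff main (F : nat -> nat -> Prop) : U [set i | U [set j | F i j]] ->
    exists e : nat -> nat, (forall m n, (m < n)%N -> (e m < e n)%N) /\
      (forall m n, (m < n)%N -> F (e m) (e n)).
  have [h|h] := in_ultra_setVsetC [set i | U [set j | E i j]] UU.
    by have [e [e1 e2]] := main _ h; exists e; split => //; left.
  have [|e [e1 e2]] := main (fun i j => ~ E i j); last by exists e; split => //; right.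
  apply: filterS h => i /= Ui.
  by have [//|] := in_ultra_setVsetC [set j | E i j] UU.
set B := [set i | _] => UB.
(* A finite list inside [B] leaves a [U]-large set of candidates for the next element. *)
have step (l : seq nat) : exists a, (forall b, b \in l -> B b) ->
    B a /\ forall b, b \in l -> F b a /\ (b < a)%N.
  have [lB|nlB] := pselect (forall b, b \in l -> B b); last by exists 0%N.
  suff : U [set a | B a /\ forall b, b \in l -> F b a /\ (b < a)%N].
    by move=> /filter_ex[a ha]; exists a.
  elim: l lB => [|b l IH] lB; first by apply: filterS UB => a Ba; split.
  have Bb : B b by apply: lB; rewrite mem_head.
  have /IH : forall b', b' \in l -> B b' by move=> b' h; apply: lB; rewrite inE h orbT.
  move=> h; apply: filterS (filterI (filterI h Bb) (Uge b.+1)).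
  move=> a [[[Ba h1] h2] h3]; split=> // b'; rewrite inE => /predU1P[->//|]; exact: h1.
have [pk hpk] := choice step.
pose L := fix L n := if n is m.+1 then pk (L m) :: L m else [::].
have LB n : forall b, b \in L n -> B b.
  elim: n => //= n IH b; rewrite inE => /predU1P[->|]; last exact: IH.
  exact: (hpk _ IH).1.
have Lmem m n : (m < n)%N -> pk (L m) \in L n.
  elim: n => // n IH; rewrite ltnS leq_eqVlt => /predU1P[->|/IH h] /=.
    by rewrite mem_head.
  by rewrite inE h orbT.
by exists (fun n => pk (L n)); split => m n /Lmem /((hpk _ (LB n)).2 _)[].
Qed.

End Ultrafilter.

(** The last clause records that each pair comes from the graph of [f] or the reversed graph of [g];
    this is what allows norms to be compared along [h]. *)
Lemma cantor_bernstein_graph (S T : Type) (f : S -> T) (g : T -> S) :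
  injective f -> injective g ->
  exists h : S -> T, bijective h /\ forall x, h x = f x \/ x = g (h x).
Proof.
move=> finj ginj.
(* The points whose backward orbit under [g \o f] reaches a point outside the range of [g]; [h] is
   [f] there and the inverse of [g] elsewhere. *)
pose C x := exists n y, ~ (exists t, g t = y) /\ x = iter n (g \o f) y.
have C_gf x : C x -> C (g (f x)) by move=> [n [y [ny ->]]]; exists n.+1, y.
have range_g x : ~ C x -> exists t, g t = x.
  by move=> nC; apply: contrapT => nt; apply: nC; exists 0%N, x.
have /choice[h hP] x : exists t, (C x -> t = f x) /\ (~ C x -> g t = x).
  have [Cx|nCx] := pselect (C x); first by exists (f x).
  by have [t gt] := range_g x nCx; exists t.
have hinj : injective h.
  move=> x x' hx; have [Cx|nCx] := pselect (C x).
    have [Cx'|nCx'] := pselect (C x').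
      by apply: finj; rewrite -(hP x).1// -(hP x').1.
    by exfalso; apply: (nCx'); rewrite -((hP x').2 nCx') -hx (hP x).1//; exact: C_gf.
  have [Cx'|nCx'] := pselect (C x').
    by exfalso; apply: (nCx); rewrite -((hP x).2 nCx) hx (hP x').1//; exact: C_gf.
  by rewrite -((hP x).2 nCx) hx (hP x').2.
have hsurj t : exists x, h x = t.
  have [[n [y [ny gt]]]|nC] := pselect (C (g t)); last first.
    by exists (g t); apply: ginj; rewrite (hP _).2.
  case: n gt => [gt|n /= /ginj ->]; first by exfalso; apply: ny; exists t.
  by exists (iter n (g \o f) y); rewrite (hP _).1//; exists n, y.
have [k hk] := choice hsurj.
exists h; split; first by exists k => // x; apply: hinj.
move=> x; have [Cx|nCx] := pselect (C x); first by left; rewrite (hP x).1.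
by right; rewrite (hP x).2.
Qed.

(** * Tree norms *)

Section TreeSpace.
Variables (R : realType) (Nd : eqType) (cmp : Nd -> Nd -> Prop) (lab : Nd -> nat).
Variable nd : nat -> Nd.
Hypothesis cmp_refl : forall t, cmp t t.
Hypothesis cmp_sym : forall t t', cmp t t' -> cmp t' t.

(* The weights m `^ (gam l - 1) give a sum of m basis vectors at one node the norm m `^ gam l. *)
Definition gam (l : nat) : R := l.+2%:R^-1.

Lemma gam_gt0 l : 0 < gam l. Proof. by rewrite invr_gt0. Qed.

Lemma gam_lt1 l : gam l < 1.
Proof. by rewrite invf_lt1// ltr1n. Qed.

Lemma gam_inj : injective gam.
Proof. by move=> l l' /invr_inj/eqP; rewrite eqr_nat => /eqP[]. Qed.

Definition chain_support :=
  {S : seq nat | uniq S /\ forall i j, i \in S -> j \in S -> cmp (nd i) (nd j)}.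

Definition mult (S : seq nat) (t : Nd) := count (fun i => nd i == t) S.

(** Indices of [S] at the same node share a weight given by their number, and the contributions of
    different nodes of the chain add up. *)
Definition tree_weight (S : chain_support) (j : nat) : R :=
  if j \in sval S then (mult (sval S) (nd j))%:R `^ (gam (lab (nd j)) - 1) else 0.

Lemma mult_gt0 S j : j \in S -> (0 < mult S (nd j))%N.
Proof. by move=> jS; rewrite -has_count; apply/hasP; exists j. Qed.

Lemma powR_gam_anti l a b : (0 < a <= b)%N ->
  b%:R `^ (gam l - 1) <= a%:R `^ (gam l - 1).
Proof.
move=> /andP[a0 ab]; rewrite -opprB !powRN lef_pV2 ?posrE ?powR_gt0 ?ltr0n//; last lia.
by apply: ge0_ler_powR; rewrite ?nnegrE ?ler_nat ?ler0n// subr_ge0 ltW// gam_lt1.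
Qed.

Lemma tree_weight_ge0 S j : 0 <= tree_weight S j.
Proof. by rewrite /tree_weight; case: ifP => // _; exact: powR_ge0. Qed.

Lemma tree_weight_le1 S j : tree_weight S j <= 1.
Proof.
rewrite /tree_weight; case: ifP => // jS.
have := @powR_gam_anti (lab (nd j)) 1 (mult (sval S) (nd j)).
by rewrite powR1; apply; rewrite mult_gt0.
Qed.

Lemma tree_weight_norming j : exists S, tree_weight S j = 1.
Proof.
have h : uniq [:: j] /\ forall i i', i \in [:: j] -> i' \in [:: j] -> cmp (nd i) (nd i').
  by split => // i i'; rewrite !inE => /eqP-> /eqP->.
exists (exist _ [:: j] h : chain_support); rewrite /tree_weight/= mem_head /mult/= eqxx.
by rewrite powR1.
Qed.

Definition tree_basis := @solid_basis R chain_support tree_weight tree_weight_le1.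

(* The sum of the first m vectors of the sequence e has norm m `^ g. *)
Definition has_type (e : nat -> nat) (g : R) := forall m,
  (forall S, \sum_(k <- iota 0 m) tree_weight S (e k) <= m%:R `^ g) /\
  ((0 < m)%N -> exists S, \sum_(k <- iota 0 m) tree_weight S (e k) >= m%:R `^ g).

(** If [p] of the [m] indices lie in [S], the multiplicity of [t] in [S] is at least [p], so their
    contribution is at most the power of [p] with exponent [gam (lab t)]. The support made of the
    [m] indices attains the value for [m]. *)
Lemma type_same_node e t : injective e -> (forall k, nd (e k) = t) ->
  has_type e (gam (lab t)).
Proof.
move=> ei et m; split=> [S|m0].
  pose p := count (fun k => e k \in sval S) (iota 0 m).
  have -> : \sum_(k <- iota 0 m) tree_weight S (e k) =
      p%:R * (mult (sval S) t)%:R `^ (gam (lab t) - 1).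
    rewrite /p; elim: (iota 0 m) => [|k s IH]; first by rewrite big_nil mul0r.
    rewrite big_cons IH /tree_weight /= et natrD mulrDl; congr (_ + _).
    by case: (e k \in _); rewrite ?mul1r ?mul0r.
  have [->|p0] := posnP p; first by rewrite mul0r powR_ge0.
  have pm : (p <= m)%N by rewrite -[leqRHS](size_iota 0 m) count_size.
  have pc : (p <= mult (sval S) t)%N.
    rewrite /p /mult -!size_filter -(size_map e).
    apply: uniq_leq_size; first by rewrite map_inj_uniq// filter_uniq// iota_uniq.
    move=> j /mapP[k]; rewrite !mem_filter => /andP[kS _] ->.
    by rewrite et eqxx.
  have h : p%:R * (mult (sval S) t)%:R `^ (gam (lab t) - 1) <=
      p%:R * p%:R `^ (gam (lab t) - 1).
    by rewrite ler_wpM2l// powR_gam_anti// p0.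
  rewrite (le_trans h)// mulr_powRB1 ?gam_gt0//.
  by apply: ge0_ler_powR; rewrite ?nnegrE ?ler_nat// ltW// gam_gt0.
have h : uniq (map e (iota 0 m)) /\
    forall i j, i \in map e (iota 0 m) -> j \in map e (iota 0 m) -> cmp (nd i) (nd j).
  split; first by rewrite map_inj_uniq// iota_uniq.
  by move=> i j /mapP[k _ ->] /mapP[k' _ ->]; rewrite !et.
exists (exist _ (map e (iota 0 m)) h : chain_support).
rewrite (eq_big_seq (fun=> m%:R `^ (gam (lab t) - 1))) => [|k km].
  rewrite big_const_seq count_predT size_iota iter_addr_0 -[leRHS]mulr_natl.
  by rewrite mulr_powRB1 ?gam_gt0.
rewrite /tree_weight/= map_f// et; congr (_%:R `^ _).
rewrite /mult count_map (eq_count (a2 := predT)) ?count_predT ?size_iota//.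
by move=> i /=; rewrite et eqxx.
Qed.

(** Behaviour of l^1: weights are at most 1, and equal 1 on the support made of the [m] indices,
    whose multiplicities are all 1. *)
Lemma type_chain e : injective (nd \o e) -> (forall k l, cmp (nd (e k)) (nd (e l))) ->
  has_type e 1.
Proof.
move=> ni ch m; rewrite powRr1//; split=> [S|m0].
  rewrite (le_trans (ler_sum _ (fun k _ => tree_weight_le1 S (e k))))//.
  by rewrite big_const_seq count_predT size_iota iter_addr_0.
have ei : injective e by move=> k l ekl; apply: ni; rewrite /= ekl.
have h : uniq (map e (iota 0 m)) /\
    forall i j, i \in map e (iota 0 m) -> j \in map e (iota 0 m) -> cmp (nd i) (nd j).
  split; first by rewrite map_inj_uniq// iota_uniq.
  by move=> i j /mapP[k _ ->] /mapP[k' _ ->].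
exists (exist _ (map e (iota 0 m)) h : chain_support).
rewrite (eq_big_seq (fun=> 1)) => [|k km].
  by rewrite big_const_seq count_predT size_iota iter_addr_0.
rewrite /tree_weight/= map_f//.
rewrite (_ : mult _ _ = 1%N) ?powR1// /mult count_map.
rewrite (eq_count (a2 := pred1 k)) => [|i /=].
  by rewrite count_uniq_mem ?iota_uniq// km.
by apply/eqP/eqP => [/ni|->].
Qed.

(** Behaviour of c_0: a chain support contains at most one of the indices. *)
Lemma type_antichain e : injective e ->
  (forall k l, (k < l)%N -> ~ cmp (nd (e k)) (nd (e l))) -> has_type e 0.
Proof.
move=> ei ac m; rewrite powRr0; split=> [[S [uS chS]]|m0].
  rewrite (bigID (fun k => e k \in S))/= [X in _ + X]big1 => [|k /negPf ekS]; last first.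
    by rewrite /tree_weight/= ekS.
  rewrite addr0 -big_filter.
  set s := [seq k <- iota 0 m | e k \in S]; have su : uniq s by rewrite filter_uniq// iota_uniq.
  have sS k : k \in s -> e k \in S by rewrite mem_filter => /andP[].
  case: s su sS => [|k [|l s]] su sS; first by rewrite big_nil.
    by rewrite big_seq1 tree_weight_le1.
  have kS : e k \in S by apply: sS; rewrite mem_head.
  have lS : e l \in S by apply: sS; rewrite !inE eqxx orbT.
  move: su; rewrite /= inE negb_or => /andP[/andP[kl _] _].
  exfalso; case: (ltngtP k l) kl => // kl _; apply: ac kl _; exact: chS.
have [S hS] := tree_weight_norming (e 0%N); exists S.
case: m m0 => // m _; rewrite /= big_cons hS lerDl.
by apply: sumr_ge0 => k _; exact: tree_weight_ge0.
Qed.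

(** Ramsey's theorem is applied twice: to equality of nodes, then to comparability. *)
Lemma node_sequence_type (e : nat -> nat) : injective e -> exists e' : nat -> nat,
  (forall m n, (m < n)%N -> (e' m < e' n)%N) /\
  [\/ exists t, forall k, nd (e (e' k)) = t,
      injective (nd \o e \o e') /\ (forall k l, cmp (nd (e (e' k))) (nd (e (e' l)))) |
      forall k l, (k < l)%N -> ~ cmp (nd (e (e' k))) (nd (e (e' l)))].
Proof.
move=> ei; have [e1 [i1 h1]] := ramsey_pairs (fun k l => nd (e k) = nd (e l)).
have [hc|hd] := h1.
  exists e1; split => //; apply: Or31; exists (nd (e (e1 0%N))).
  by move=> [|k]//; rewrite (hc 0%N k.+1).
have [e2 [i2 h2]] := ramsey_pairs (fun k l => cmp (nd (e (e1 k))) (nd (e (e1 l)))).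
exists (e1 \o e2); split; first by move=> m n /i2/i1.
have [hc|ha] := h2; [apply: Or32|exact: Or33].
split=> [k l /= kl|k l /=].
  by case: (ltngtP k l) => // /i2; [move=> /hd|move=> /hd/nesym]; case/(_ kl).
by case: (ltngtP k l) => [/hc//|/hc/cmp_sym//|->]; exact: cmp_refl.
Qed.

Lemma powR_dominated_le (K : nat) (g g' : R) :
  (forall m, (0 < m)%N -> m%:R `^ g' <= K%:R * m%:R `^ g) -> g' <= g.
Proof.
move=> h; rewrite leNgt; apply/negP => gg.
have d0 : 0 < g' - g by rewrite subr_gt0.
(* At [x] the power of exponent [g' - g] equals [K + 1]; any integer beyond [x] violates the
   hypothesis. *)
pose x : R := (K%:R + 1) `^ (g' - g)^-1.
pose m := (Num.truncn x).+1.
have xm : x < m%:R by exact: truncnS_gt.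
have m0 : 0 < m%:R :> R by rewrite ltr0n.
have := h m isT; rewrite -ler_pdivrMr ?powR_gt0//.
rewrite -powRN -powRD; last by rewrite gt_eqF ?implybT.
apply/negP; rewrite -ltNge.
have : K%:R + 1 < m%:R `^ (g' - g).
  have -> : K%:R + 1 = x `^ (g' - g).
    by rewrite /x -powRrM mulVf ?gt_eqF// powRr1// addr_ge0.
  by apply: gt0_ltr_powR; rewrite ?nnegrE ?powR_ge0.
by apply: lt_trans; rewrite ltrDl.
Qed.

Lemma dominated_type_le (rho rho' : nat -> nat) (K : nat) (e : nat -> nat) g g' :
  injective rho -> injective rho' -> injective e ->
  dominated (tree_basis \o rho) (tree_basis \o rho') K%:R ->
  has_type (rho \o e) g -> has_type (rho' \o e) g' -> g' <= g.
Proof.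
move=> ir ir' ie dom tg tg'; apply: (@powR_dominated_le K) => m m0.
have [S hS] := (tg' m).2 m0; apply: le_trans hS _.
rewrite /= -(big_map e xpredT (fun k => tree_weight S (rho' k))).
apply: (solid_dominated_sum tree_weight_ge0 ir ir' _ dom) => //.
- by rewrite map_inj_uniq// iota_uniq.
- by rewrite powR_gt0// ltr0n.
by move=> S'; rewrite big_map; exact: (tg m).1.
Qed.

(** * Growth exponents under equivalence *)

Section Rigidity.
Variables (rho rho' : nat -> nat) (K : nat).
Hypothesis rho_inj : injective rho.
Hypothesis rho'_inj : injective rho'.
Hypothesis dom : dominated (tree_basis \o rho) (tree_basis \o rho') K%:R.
Hypothesis dom' : dominated (tree_basis \o rho') (tree_basis \o rho) K%:R.

Lemma equivalent_type_eq (e : nat -> nat) g g' : injective e ->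
  has_type (rho \o e) g -> has_type (rho' \o e) g' -> g = g'.
Proof.
move=> ei tg tg'; apply/eqP; rewrite eq_le.
by rewrite (dominated_type_le _ _ _ dom tg tg')// (dominated_type_le _ _ _ dom' tg' tg).
Qed.

(** The exponent [gam (lab t)] lies strictly between 0 and 1, which excludes chains and antichains
    among the images. Some subsequence of images therefore sits at a single node, whose label is
    recovered by injectivity of [gam]. *)
Lemma label_preserved (e : nat -> nat) t : injective e -> (forall k, nd (rho (e k)) = t) ->
  exists k, lab (nd (rho' (e k))) = lab t.
Proof.
move=> ei et.
have [e' [ie' he']] := node_sequence_type (inj_comp rho'_inj ei).
have e'i : injective e' by apply: increasing_inj => n; exact: ie'.
have eei : injective (e \o e') by exact: inj_comp.
have tl : has_type (rho \o (e \o e')) (gam (lab t)).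
  by apply: type_same_node; [exact: inj_comp|move=> k /=; rewrite et].
case: he' => [[t' ht']|[ni ch]|ac].
- exists (e' 0%N); rewrite (_ : nd _ = t'); last exact: (ht' 0%N).
  apply/esym/gam_inj; apply: (equivalent_type_eq eei tl).
  by apply: type_same_node => //; exact: inj_comp.
- have := equivalent_type_eq eei tl (type_chain ni ch).
  by move=> h; have := gam_lt1 (lab t); rewrite h ltxx.
have tr : has_type (rho' \o (e \o e')) 0.
  exact: (type_antichain (inj_comp rho'_inj eei) ac).
by have := gam_gt0 (lab t); rewrite (equivalent_type_eq eei tl tr) ltxx.
Qed.

(** Exponent 1 excludes an antichain, and distinct image nodes exclude a single node. *)
Lemma chain_preserved (e : nat -> nat) : injective (nd \o rho \o e) ->
  (forall k l, cmp (nd (rho (e k))) (nd (rho (e l)))) ->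
  injective (nd \o rho' \o e) ->
  exists e', (forall m n, (m < n)%N -> (e' m < e' n)%N) /\
    forall k l, cmp (nd (rho' (e (e' k)))) (nd (rho' (e (e' l)))).
Proof.
move=> ni ch ni'.
have ei : injective e by move=> k l ekl; apply: ni; rewrite /= ekl.
have [e' [ie' he']] := node_sequence_type (inj_comp rho'_inj ei).
have e'i : injective e' by apply: increasing_inj => n; exact: ie'.
have eei : injective (e \o e') by exact: inj_comp.
exists e'; split => //.
case: he' => [[t' ht']|[]//|ac].
  have : e' 0%N = e' 1%N by apply: ni'; rewrite /= (ht' 0%N) (ht' 1%N).
  by move=> /e'i.
have tl : has_type (rho \o (e \o e')) 1.
  apply: type_chain; first by move=> k l kl; apply/e'i/ni.
  by move=> k l; exact: ch.
have tr : has_type (rho' \o (e \o e')) 0 := (type_antichain (inj_comp rho'_inj eei) ac).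
have := equivalent_type_eq eei tl tr.
by move/eqP; rewrite oner_eq0.
Qed.

End Rigidity.

(** * Embeddings of indices lying over embeddings of nodes *)

Definition node_embedding (H : nat -> nat) (h : Nd -> Nd) :=
  [/\ injective H, injective h, forall j, nd (H j) = h (nd j),
    forall t, lab (h t) = lab t & forall t t', cmp (h t) (h t') <-> cmp t t'].

Lemma weight_pushforward H h S : node_embedding H h ->
  exists S', forall j, tree_weight S j <= tree_weight S' (H j).
Proof.
move=> [Hi hi Hh hl hc]; case: S => S [uS cS].
have h' : uniq (map H S) /\
    forall i j, i \in map H S -> j \in map H S -> cmp (nd i) (nd j).
  split; first by rewrite map_inj_uniq.
  by move=> _ _ /mapP[i iS ->] /mapP[j jS ->]; rewrite !Hh; apply/hc; exact: cS.
exists (exist _ (map H S) h' : chain_support) => j; rewrite /tree_weight/= mem_map//; case: ifP => // _.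
rewrite Hh hl (_ : mult (map H S) _ = mult S (nd j))// /mult count_map.
by apply: eq_count => i /=; rewrite Hh (inj_eq hi).
Qed.

(** The preimage of [S] is a chain support. Its multiplicities can be smaller than those of [S],
    which only increases the weights. *)
Lemma weight_pullback H h S : node_embedding H h ->
  exists S', forall j, tree_weight S (H j) <= tree_weight S' j.
Proof.
move=> [Hi hi Hh hl hc]; case: S => S [uS cS].
have /choice[G HG] n : exists j, forall i, H i = n -> j = i.
  have [[j Hj]|nj] := pselect (exists j, H j = n).
    by exists j => i; rewrite -Hj => /Hi.
  by exists 0%N => i Hin; exfalso; apply: nj; exists i.
pose S' := [seq j <- undup (map G S) | H j \in S].
have memS' j : j \in S' = (H j \in S).
  rewrite mem_filter; case: (boolP (H j \in S)) => // HjS /=.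
  by rewrite mem_undup; apply/mapP; exists (H j) => //; rewrite (HG _ j).
have uS' : uniq S' by rewrite filter_uniq// undup_uniq.
have h' : uniq S' /\ forall i j, i \in S' -> j \in S' -> cmp (nd i) (nd j).
  by split=> // i j; rewrite !memS' => iS jS; apply/hc; rewrite -!Hh; exact: cS.
exists (exist _ S' h' : chain_support) => j; rewrite /tree_weight/= memS'; case: ifP => // HjS.
rewrite Hh hl; apply: powR_gam_anti; rewrite mult_gt0 ?memS'//=.
rewrite /mult -!size_filter -(size_map H); apply: uniq_leq_size.
  by rewrite map_inj_uniq// filter_uniq.
move=> _ /mapP[i + ->]; rewrite mem_filter memS' => /andP[/eqP ni HiS].
by rewrite mem_filter HiS Hh ni eqxx.
Qed.

(** A weight at [rho' k] is bounded by one at [rho k], pulled back along [H] or pushed forward along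
    [H'] according to the case; the sum of the two weights works for all [k], whence [e / 2]. *)
Lemma node_embedding_cvg (rho rho' : nat -> nat) H h H' h' a :
  injective rho -> injective rho' -> node_embedding H h -> node_embedding H' h' ->
  (forall k, rho' k = H (rho k) \/ rho k = H' (rho' k)) ->
  cvg (series (fun k => a k *: tree_basis (rho k)) @ \oo) ->
  cvg (series (fun k => a k *: tree_basis (rho' k)) @ \oo).
Proof.
move=> ir ir' eH eH' hr.
move=> /(solid_cvgP tree_weight_ge0 tree_weight_le1 a ir) ca.
apply/(solid_cvgP tree_weight_ge0 tree_weight_le1 a ir') => e e0.
have e2 : 0 < e / 2 by rewrite divr_gt0.
have [N hN] := ca _ e2; exists N => n S Nn.
have [S1 h1] := weight_pullback S eH.
have [S2 h2] := weight_pushforward S eH'.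
rewrite [e]splitr; apply: le_trans (lerD (hN n S1 Nn) (hN n S2 Nn)).
rewrite -big_split/=; apply: ler_sum => k _.
rewrite -mulrDl ler_wpM2r//.
have [->|->] := hr k.
  by rewrite (le_trans (h1 _))// lerDl tree_weight_ge0.
by rewrite (le_trans (h2 _))// lerDr tree_weight_ge0.
Qed.

Lemma node_embedding_equiv (rho rho' : nat -> nat) H h H' h' :
  injective rho -> injective rho' -> node_embedding H h -> node_embedding H' h' ->
  (forall k, rho' k = H (rho k) \/ rho k = H' (rho' k)) ->
  seq_equiv (tree_basis \o rho) (tree_basis \o rho').
Proof.
move=> ir ir' eH eH' hr a; split.
  exact: (node_embedding_cvg ir ir' eH eH').
apply: (node_embedding_cvg ir' ir eH' eH) => k.
by have [] := hr k; [right|left].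
Qed.

End TreeSpace.

(** * Coding of analytic equivalence relations *)

Section ChainApproximation.
Variable C : (nat -> bool) -> (nat -> bool) -> (nat -> nat) -> Prop.
Hypothesis C_closed : forall p q d,
  (forall n, exists p' q' d', C p' q' d' /\ [/\ agree n p p', agree n q q' & agree n d d']) ->
  C p q d.

(** The first alternative is an idle step, which lets a short chain be prolonged to a prescribed
    length. *)
Definition link (n : nat) (b : nat -> nat) (p q : nat -> bool) :=
  agree n p q \/ exists p' q' d, C p' q' d /\
    [/\ agree n p p', agree n q q' & forall j, (j < n)%N -> (d j <= b j)%N].

(** [b 0] is both the number of steps and a bound on the first witness entry, so a single sequence
    carries all the data. *)
Definition approx (n : nat) (b : nat -> nat) (p q : nat -> bool) :=
  exists P : nat -> nat -> bool, [/\ agree n (P 0%N) p, agree n (P (b 0%N)) q &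
    forall i, (i < b 0)%N -> link n b (P i) (P i.+1)].

Lemma link_mono m n b b' p q : (m <= n)%N -> (forall j, (j < m)%N -> (b j <= b' j)%N) ->
  link n b p q -> link m b' p q.
Proof.
move=> mn bb [h|[p' [q' [d [Cd [h1 h2 h3]]]]]]; first by left; exact: agree_le h.
right; exists p', q', d; split => //; split; [exact: agree_le h1|exact: agree_le h2|].
by move=> j jm; rewrite (leq_trans (h3 _ _)) ?bb// (leq_trans jm).
Qed.

Lemma link_agree n b p q p' q' : agree n p p' -> agree n q q' ->
  link n b p q -> link n b p' q'.
Proof.
move=> pp qq [h|[p1 [q1 [d [Cd [h1 h2 h3]]]]]].
  by left; apply: agree_trans (agree_sym pp) (agree_trans h qq).
right; exists p1, q1, d; split => //; split=> //.
  exact: agree_trans (agree_sym pp) h1.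
exact: agree_trans (agree_sym qq) h2.
Qed.

Lemma approx_agree n b b' p q p' q' : agree n b b' -> agree n p p' -> agree n q q' ->
  approx n b p q -> approx n b' p' q'.
Proof.
(* At precision 0 the agreement of [b] and [b'] says nothing about [b 0], but then any chain will
   do. *)
case: n => [|n] bb pp qq [P [h0 h1 hl]]; first by exists (fun=> p); split => // i _; left.
exists P; rewrite -bb//; split; [exact: agree_trans pp|exact: agree_trans qq|].
move=> i /hl; apply: link_mono => // j jn; by rewrite bb.
Qed.

Lemma approx_le m n b p q : (m <= n)%N -> approx n b p q -> approx m b p q.
Proof.
move=> mn [P [h0 h1 hl]]; exists P; split; [exact: agree_le h0|exact: agree_le h1|].
by move=> i /hl; apply: link_mono.
Qed.

Lemma approx_refl n p : approx n (fun=> 0%N) p p.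
Proof. by exists (fun=> p). Qed.

(** Chains are concatenated: their lengths add, and the sum weakens both bounds. *)
Lemma approx_trans n b c p q r : approx n b p q -> approx n c q r ->
  approx n (fun j => b j + c j)%N p r.
Proof.
move=> [P [P0 P1 Pl]] [Q [Q0 Q1 Ql]].
exists (fun i => if (i <= b 0)%N then P i else Q (i - b 0)%N); split => //.
  case: leqP => [h|_]; last by rewrite addKn.
  have c0 : c 0%N = 0%N by lia.
  rewrite c0 addn0; rewrite c0 in Q1.
  exact: agree_trans P1 (agree_trans (agree_sym Q0) Q1).
move=> i ilt; case: (ltngtP i (b 0%N)) => ib.
- by apply: link_mono (Pl _ ib) => // j _; rewrite leq_addr.
- rewrite subSn ?(ltnW ib)//.
  by apply: link_mono (Ql _ _) => //; [move=> j _; rewrite leq_addl|lia].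
rewrite -ib subSn// subnn.
apply: link_agree (link_mono (leqnn n) _ (Ql 0%N _)) => //; last by lia.
  by rewrite ib; exact: agree_trans Q0 (agree_sym P1).
by move=> j _; rewrite leq_addl.
Qed.

(* Compactness of the space of chains with coefficients bounded by b, via an ultralimit. *)
Lemma approx_limit b p q : (forall n, approx n b p q) ->
  exists P : nat -> nat -> bool, [/\ P 0%N = p, P (b 0%N) = q &
    forall i, (i < b 0)%N -> P i = P i.+1 \/ exists d, C (P i) (P i.+1) d].
Proof.
move=> /choice[P hP].
have [U [UU Uge]] := free_ultrafilter.
have FU : Filter U by exact: filter_filter.
have /choice[Q hQ] i : exists Qi : nat -> bool, forall k, U [set n | P n i k = Qi k].
  have /choice[Qi hQi] k : exists v, U [set n | P n i k = v].
    exact: (ultra_bool_const (fun n => P n i k)).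
  by exists Qi.
have Qagree i m : U [set n | agree m (P n i) (Q i)].
  by apply: ultra_agree => k _; exact: hQ.
have Qlim i x : (forall n, agree n (P n i) x) -> Q i = x.
  move=> hx; apply/funext => k.
  have [n [/= h1 h2]] := filter_ex (filterI (Qagree i k.+1) (Uge k.+1)).
  by rewrite -h1// hx.
exists Q; split; try by apply: Qlim => n; have [] := hP n.
move=> i ib.
(* If step [i] is idle for almost all [n], it is idle in the limit. Otherwise the entries of the
   witnesses are bounded by [b], hence constant along the ultrafilter. *)
have [h|h] := in_ultra_setVsetC [set n | agree n (P n i) (P n i.+1)] UU.
  left; apply/funext => k.
  have [n [[[/= h1 h2] h3] h4]] := filter_ex
    (filterI (filterI (filterI h (Qagree i k.+1)) (Qagree i.+1 k.+1)) (Uge k.+1)).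
  by rewrite -h2// -h3// h1.
right.
have /choice[z hz] n : exists z : (nat -> bool) * (nat -> bool) * (nat -> nat),
    ~ agree n (P n i) (P n i.+1) -> C z.1.1 z.1.2 z.2 /\
    [/\ agree n (P n i) z.1.1, agree n (P n i.+1) z.1.2 &
      forall j, (j < n)%N -> (z.2 j <= b j)%N].
  have [_ _ /(_ i ib)[ag|[p' [q' [d hd]]]]] := hP n.
    by exists (p, q, b) => /(_ ag).
  by exists (p', q', d).
have /choice[d hd] j : exists v, U [set n | (z n).2 j = v].
  have [|v _ hv] := @ultra_bounded_const U (fun n => (z n).2 j) (b j) UU; last by exists v.
  apply: filterS (filterI h (Uge j.+1)) => n [/= nag jn].
  by have [_ [_ _]] := hz n nag; apply.
exists d; apply: C_closed => m.
have dag : U [set n | agree m ((z n).2) d] by apply: ultra_agree => j _; exact: hd.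
have [n [[[[/= h1 h2] h3] h4] h5]] := filter_ex
  (filterI (filterI (filterI (filterI h (Qagree i m)) (Qagree i.+1 m)) dag) (Uge m)).
have [Cz [z1 z2 _]] := hz n h1.
exists (z n).1.1, (z n).1.2, (z n).2; split => //; split.
- exact: agree_trans (agree_sym h2) (agree_le h5 z1).
- exact: agree_trans (agree_sym h3) (agree_le h5 z2).
- exact: agree_sym.
Qed.

Definition node : Type := (seq bool * seq nat)%type.

Definition node_cmp (t t' : node) := forall i, (i < size t.2)%N -> (i < size t'.2)%N ->
  nth 0%N t.2 i = nth 0%N t'.2 i.

Definition node_label (t : node) : nat := pickle t.1.

(** Membership in the tree [T_p]. The defaults of [nth] are harmless: precision [n] sees only the
    first [n] entries. *)
Definition node_in (p : nat -> bool) (t : node) :=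
  size t.1 = size t.2 /\ approx (size t.2) (nth 0%N t.2) (nth false t.1) p.

Definition node_shift (a : nat -> nat) (t : node) : node :=
  (t.1, mkseq (fun i => nth 0 t.2 i + a i)%N (size t.2)).

Definition node_at (p : nat -> bool) (n : nat) : node := (mkseq p n, nseq n 0%N).

Lemma node_cmp_refl t : node_cmp t t. Proof. by []. Qed.

Lemma node_cmp_sym t t' : node_cmp t t' -> node_cmp t' t.
Proof. by move=> h i i1 i2; rewrite h. Qed.

Lemma node_shift_inj a : injective (node_shift a).
Proof.
move=> [u s] [u' s'] [-> ss]; congr pair.
have sz : size s = size s' by have := congr1 size ss; rewrite !size_mkseq.
apply: (@eq_from_nth _ 0%N) => // i i_s.
by have := congr1 (fun l => nth 0%N l i) ss; rewrite !nth_mkseq -?sz//; lia.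
Qed.

Lemma node_shift_cmp a t t' : node_cmp (node_shift a t) (node_shift a t') <-> node_cmp t t'.
Proof.
rewrite /node_cmp /node_shift /= !size_mkseq.
split=> h i i1 i2; have := h i i1 i2; rewrite !nth_mkseq//; last by move=> ->.
by move/addIn.
Qed.

Lemma node_shift_in a p q t : (forall n, approx n a p q) ->
  node_in p t -> node_in q (node_shift a t).
Proof.
move=> apq [sz h]; split; rewrite /= size_mkseq//.
apply: approx_agree (approx_trans h (apq _)) => // i i_s.
by rewrite nth_mkseq.
Qed.

Lemma node_at_in p n : node_in p (node_at p n).
Proof.
split; rewrite /= ?size_mkseq ?size_nseq//.
apply: approx_agree (approx_refl n p) => // i i_n; first by rewrite nth_nseq if_same.
by rewrite nth_mkseq.
Qed.

Lemma approx_of_chain p q (t : nat -> node) (n : nat -> nat) :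
  (forall k, (k <= n k)%N) -> (forall k, (t k).1 = mkseq p (n k)) ->
  (forall k, node_in q (t k)) -> (forall k l, node_cmp (t k) (t l)) ->
  exists b, forall k, approx k b p q.
Proof.
move=> nk tp tq tc.
have sz k : size (t k).2 = n k by have [<- _] := tq k; rewrite tp size_mkseq.
(* Node [t j.+1] is long enough to have an entry [j], and comparability makes it agree with every
   node reaching that far. *)
exists (fun j => nth 0%N (t j.+1).2 j) => k.
have [_ h] := tq k.
rewrite sz in h; apply: approx_agree (approx_le (nk k) h).
- move=> i ik; apply: tc; rewrite sz ?nk//; exact: leq_trans ik (nk k).
- by move=> i ik; rewrite tp nth_mkseq//; exact: leq_trans ik (nk k).
- by [].
Qed.

Variable R : realType.
Variable idx : nat -> node * nat.
Variable idx_inv : node * nat -> nat.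
Hypothesis idxK : cancel idx idx_inv.
Hypothesis idx_invK : cancel idx_inv idx.

(** An index codes a node and a copy number, so each node carries infinitely many basis vectors. *)
Definition node_of (j : nat) : node := (idx j).1.

Definition coded_basis := @tree_basis R node node_cmp node_label node_of.

Definition coded_set (p : nat -> bool) : set nat := [set j | node_in p (node_of j)].

Let shift_index (a : nat -> nat) (j : nat) := idx_inv (node_shift a (node_of j), (idx j).2).

Let shift_embedding a :
  node_embedding node_cmp node_label node_of (shift_index a) (node_shift a).
Proof.
split.
- move=> j j' /(can_inj idx_invK) /= [] h1 h2 h3.
  apply: (can_inj idxK); rewrite [idx j]surjective_pairing [idx j']surjective_pairing.
  by rewrite h3 (@node_shift_inj a (idx j).1 (idx j').1)// /node_shift h1 h2.
- exact: node_shift_inj.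
- by move=> j; rewrite /node_of idx_invK.
- by [].
- exact: node_shift_cmp.
Qed.

(** The shifts by [a] and [a'] inject the two coded sets into each other. The Cantor-Bernstein
    bijection follows one shift or inverts the other at each index, as [node_embedding_equiv]
    requires. *)
Lemma approx_perm_equiv p q a a' (r r' : nat -> nat) :
  injective r -> injective r' ->
  (forall j, coded_set p j <-> exists n, r n = j) ->
  (forall j, coded_set q j <-> exists n, r' n = j) ->
  (forall n, approx n a p q) -> (forall n, approx n a' q p) ->
  perm_equiv (coded_basis \o r) (coded_basis \o r').
Proof.
move=> ri ri' hr hr' apq aqp.
have /choice[H1 hH1] k : exists l, r' l = shift_index a (r k).
  apply/hr'; rewrite /coded_set/= /node_of idx_invK/=.
  by apply: node_shift_in apq _; apply/hr; exists k.
have /choice[H2 hH2] k : exists l, r l = shift_index a' (r' k).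
  apply/hr; rewrite /coded_set/= /node_of idx_invK/=.
  by apply: node_shift_in aqp _; apply/hr'; exists k.
have [ai _ _ _ _] := shift_embedding a; have [ai' _ _ _ _] := shift_embedding a'.
have H1i : injective H1 by move=> k l kl; apply/ri/ai; rewrite -!hH1 kl.
have H2i : injective H2 by move=> k l kl; apply/ri'/ai'; rewrite -!hH2 kl.
have [f [fb hf]] := cantor_bernstein_graph H1i H2i.
exists f; split => //.
apply: (node_embedding_equiv ri (inj_comp ri' (bij_inj fb))
  (shift_embedding a) (shift_embedding a')).
move=> k /=; have [->|h] := hf k; first by left.
by right; rewrite {1}h hH2.
Qed.

Lemma perm_equiv_approx p q (r r' : nat -> nat) :
  injective r -> injective r' ->
  (forall j, coded_set p j <-> exists n, r n = j) ->
  (forall j, coded_set q j <-> exists n, r' n = j) ->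
  perm_equiv (coded_basis \o r) (coded_basis \o r') ->
  exists b, forall n, approx n b p q.
Proof.
move=> ri ri' hr hr' [f [fb]].
have w0 i : coded_basis i != 0.
  apply: basic_seq_neq0; apply: solid_basis_basic.
    exact: tree_weight_ge0.
  by move=> j; exact: tree_weight_norming.
move=> /seq_equivP[].
- by move=> i; exact: w0.
- by move=> i; exact: w0.
move=> K [d1 d2].
have ri'f : injective (r' \o f) by apply: inj_comp ri' _; exact: bij_inj.
(* Among the infinitely many vectors at [node_at p n], one is sent to a node with the same label,
   that is, with first sequence [mkseq p n]. These vectors form a chain as [n] varies. *)
have /choice[e he] n : exists k, node_of (r k) = node_at p n /\
    node_label (node_of (r' (f k))) = node_label (node_at p n).
  have /choice[en hen] i : exists k, r k = idx_inv (node_at p n, i).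
    by apply/hr; rewrite /coded_set/= /node_of idx_invK; exact: node_at_in.
  have eni : injective en.
    by move=> i i' ii; have := hen i; rewrite ii hen => /(can_inj idx_invK)[].
  have nen k : node_of (r (en k)) = node_at p n by rewrite hen /node_of idx_invK.
  have [k hk] := label_preserved node_cmp_refl node_cmp_sym ri ri'f d1 d2 eni nen.
  by exists (en k); rewrite nen.
have fst_e n : (node_of (r' (f (e n)))).1 = mkseq p n.
  by apply: (pcan_inj pickleK); exact: (he n).2.
have [|||e' [ie' che']] := @chain_preserved R _ _ node_label node_of node_cmp_refl
    node_cmp_sym _ _ _ ri ri'f d1 d2 e.
- move=> m n /=; rewrite !(he _).1 => -[/(congr1 size)]; by rewrite !size_mkseq.
- move=> m n; rewrite !(he _).1 => i /=; rewrite !size_nseq => im i_n.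
  by rewrite !nth_nseq im i_n.
- by move=> m n /= h; have := fst_e m; rewrite h fst_e => /(congr1 size); rewrite !size_mkseq.
apply: (@approx_of_chain p q (fun k => node_of (r' (f (e (e' k))))) e') => //.
  by apply: increasing_ge => n; exact: ie'.
by move=> k; apply/hr'; exists (f (e (e' k))).
Qed.

End ChainApproximation.

(** * Increasing enumerations of infinite sets *)

Section Enumeration.

Lemma infinite_enumerates (N : nat -> bool) : infinite_omega N ->
  exists s, enumerates N s.
Proof.
move=> hN.
have /choice[nx hnx] m : exists n, [/\ (m <= n)%N, N n &
    forall k, (m <= k)%N -> N k -> (n <= k)%N].
  have hex : exists n, (m <= n)%N && N n by have [n [h1 h2]] := hN m; exists n; rewrite h1.
  case: (ex_minnP hex) => n /andP[h1 h2] h3; exists n; split => // k mk Nk.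
  by apply: h3; rewrite mk.
pose s := fix s n := if n is m.+1 then nx (s m).+1 else nx 0%N.
have hs n : (s n < s n.+1)%N by have [] := hnx (s n).+1.
exists s; split => // k; split=> [Nk|[n <-]]; last first.
  by case: n => [|n] /=; [have [] := hnx 0%N|have [] := hnx (s n).+1].
have hex : exists n, (k <= s n)%N by exists k; exact: increasing_ge.
case: (ex_minnP hex) => n kn hn; exists n; apply/eqP; rewrite eqn_leq kn andbT.
case: n kn hn => [|n] kn hn /=; first by have [_ _ h] := hnx 0%N; exact: h.
have [_ _ h] := hnx (s n).+1; apply: h => //.
by rewrite ltnNge; apply/negP => /hn; rewrite ltnn.
Qed.

Lemma enumerates_unique (N : nat -> bool) s t : enumerates N s -> enumerates N t -> s = t.
Proof.
move=> [hs Ns] [ht Nt]; apply/funext; elim/ltn_ind => n IH.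
have le_aux (s1 s2 : nat -> nat) : (forall n, (s1 n < s1 n.+1)%N) ->
    (forall n, (s2 n < s2 n.+1)%N) -> (forall k, N k <-> exists n, s1 n = k) ->
    (forall k, N k <-> exists n, s2 n = k) ->
    (forall m, (m < n)%N -> s1 m = s2 m) -> (s2 n <= s1 n)%N.
  move=> h1 h2 N1 N2 h12; have /N1/N2[k hk] : exists i, s1 i = s1 n by exists n.
  rewrite -hk; have [kn|] := ltnP k n; last first.
    by rewrite leq_eqVlt => /predU1P[->//|/(increasing_lt h2)/ltnW].
  by have := increasing_inj h1 (etrans (h12 k kn) hk) => kE; rewrite kE ltnn in kn.
apply/eqP; rewrite eqn_leq (le_aux t s)// ?(le_aux s t)// => m /IH//.
Qed.

Lemma enumerates_comp (A N : nat -> bool) (s r : nat -> nat) :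
  (forall n, (s n < s n.+1)%N) -> (forall k, N k <-> exists2 j, s j = k & A j) ->
  enumerates A r -> enumerates N (s \o r).
Proof.
move=> hs hN [hr hA]; split=> [n /=|k]; first exact: increasing_lt.
split=> [/hN[j <- /hA[n <-]]|[n <-]]; first by exists n.
by apply/hN; exists (r n) => //; apply/hA; exists n.
Qed.

End Enumeration.

(** * Borel maps into the Cantor space *)

Section BorelMaps.
Variable X : topologicalType.

Lemma borel_open (A : set X) : open A -> borel_set A.
Proof. exact: sub_gen_smallest. Qed.

Lemma borel_set0 : borel_set (@set0 X).
Proof. by apply: borel_open; exact: open0. Qed.

Lemma borel_setC (A : set X) : borel_set A -> borel_set (~` A).
Proof. by move=> bA; rewrite -setTD; exact: sigma_algebraCD. Qed.

Lemma borel_bigcup (F : nat -> set X) : (forall n, borel_set (F n)) ->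
  borel_set (\bigcup_n F n).
Proof. exact: sigma_algebra_bigcup. Qed.

Lemma borel_setU (A B : set X) : borel_set A -> borel_set B -> borel_set (A `|` B).
Proof.
move=> bA bB; rewrite -bigcup2E; apply: borel_bigcup => -[|[|n]] //=.
exact: borel_set0.
Qed.

Lemma borel_setI (A B : set X) : borel_set A -> borel_set B -> borel_set (A `&` B).
Proof.
move=> bA bB; rewrite -[A `&` B]setCK setCI.
exact: borel_setC (borel_setU (borel_setC bA) (borel_setC bB)).
Qed.

Variable f : X -> nat -> bool.
Hypothesis f_coord : forall k, borel_set [set x | f x k].

(** Induction on [n], splitting according to the value of the last relevant bit. *)
Lemma borel_finitary n (P : (nat -> bool) -> Prop) :
  (forall p q, agree n p q -> P p -> P q) -> borel_set [set x | P (f x)].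
Proof.
elim: n P => [|n IH] P hP.
  have [[x Px]|nP] := pselect (exists x, P (f x)).
    rewrite (_ : [set x | _] = setT); first by apply: borel_open; exact: openT.
    by apply/seteqP; split => // y _; apply: hP Px.
  rewrite (_ : [set x | _] = set0); first exact: borel_set0.
  by apply/seteqP; split => // y Py; apply: nP; exists y.
pose upd b p i := if i == n then b else p i : bool.
have hu b p : p n = b -> agree n.+1 (upd b p) p by move=> pn i _; rewrite /upd; case: eqP => [->|].
rewrite (_ : [set x | _] = ([set x | f x n] `&` [set x | P (upd true (f x))]) `|`
    (~` [set x | f x n] `&` [set x | P (upd false (f x))])); last first.
  apply/seteqP; split => x /=.
    move=> Px; case fx: (f x n); [left|right]; split => //.
      exact: hP (agree_sym (hu _ _ fx)) Px.
    exact: hP (agree_sym (hu _ _ fx)) Px.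
  move=> [[fx Px]|[/negP/negbTE fx Px]]; exact: hP (hu _ _ fx) Px.
have bu b : borel_set [set x | P (upd b (f x))].
  apply: (IH (fun p => P (upd b p))) => p q pq; apply: hP => i i_n; rewrite /upd.
  by case: eqP => // /eqP ni; apply: pq; rewrite ltn_neqAle ni -ltnS.
exact: borel_setU (borel_setI (f_coord n) (bu true))
  (borel_setI (borel_setC (f_coord n)) (bu false)).
Qed.

Lemma borel_fun_cantor : borel_fun (f : X -> cantor_space).
Proof.
move=> B oB.
rewrite (_ : f @^-1` B = \bigcup_n [set x | forall p, agree n (f x) p -> B p]).
  apply: borel_bigcup => n.
  apply: (@borel_finitary n (fun p => forall r, agree n p r -> B r)) => p q pq hp r qr.
  by apply: hp; exact: agree_trans pq qr.
apply/seteqP; split => [x /= Bx|x [n _ /=]]; last by apply.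
have /nbhs_seq_space[n hn] : nbhs (f x : cantor_space) B by exact: open_nbhs_nbhs.
by exists n.
Qed.

End BorelMaps.

(** * Coding the points of a Polish space *)

Section CodePoints.
Variables (R : realType) (X : topologicalType) (d : X -> X -> R).
Hypothesis d_eq0 : forall x y, d x y = 0 <-> x = y.
Hypothesis d_sym : forall x y, d x y = d y x.
Hypothesis d_tri : forall x y z, d x z <= d x y + d y z.
Hypothesis d_open : forall A : set X, open A <->
  (forall x, A x -> exists2 e : R, 0 < e & [set y | d x y < e] `<=` A).
Variable q : nat -> X.
Hypothesis q_dense : forall x (e : R), 0 < e -> exists i, d x (q i) < e.
Variable E : X -> X -> Prop.
Hypothesis E_equiv : equiv_relation E.
Variable g : baire_space -> X * X.
Hypothesis g_cont : continuous g.
Hypothesis g_range : range g = [set p : X * X | E p.1 p.2].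

Definition pair_code (n i : nat) : nat := pickle (n, i).

(** The non-strict inequality is preserved under limits; an index at every precision makes the coded
    point unique. *)
Definition codes (p : nat -> bool) (x : X) :=
  (forall n, exists i, p (pair_code n i)) /\
  (forall n i, p (pair_code n i) -> d x (q i) <= n.+1%:R^-1).

(** The strict inequality makes each bit an open condition on [x]. *)
Definition code (x : X) : nat -> bool := fun k =>
  if (unpickle k : option (nat * nat)) is Some (n, i) then d x (q i) < n.+1%:R^-1 else false.

Lemma code_codes x : codes (code x) x.
Proof.
split=> n; last by move=> i; rewrite /code /pair_code pickleK => /ltW.
have [i hi] : exists i, d x (q i) < n.+1%:R^-1 by apply: q_dense; rewrite invr_gt0.
by exists i; rewrite /code /pair_code pickleK.
Qed.

Lemma d_ge0 x y : 0 <= d x y.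
Proof.
have := d_tri x y x; rewrite (d_sym y x) (d_eq0 x x).2// -mulr2n.
by rewrite pmulrn_lge0.
Qed.

Lemma codes_unique p x y : codes p x -> codes p y -> x = y.
Proof.
move=> [hx1 hx] [_ hy]; apply/d_eq0/eqP; rewrite eq_le d_ge0 andbT.
apply/ler_addgt0Pr => e e0; rewrite add0r.
pose n := Num.truncn (2 / e).
have he : 2 / e < n.+1%:R by exact: truncnS_gt.
have [i hi] := hx1 n.
rewrite (le_trans (d_tri x (q i) y))// (d_sym (q i) y).
rewrite (le_trans (lerD (hx _ _ hi) (hy _ _ hi)))// -mulr2n -[leLHS]mulr_natl.
by rewrite ler_pdivrMr ?ltr0n// mulrC -ler_pdivrMr// ltW.
Qed.

(* z interleaves, for each of p and p', a choice of one index i with p (n, i) for every n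
   and, in strand 2, a point of the Baire space mapped by g to the coded pair. *)
Definition code_rel (p p' : nat -> bool) (z : nat -> nat) :=
  [/\ forall n, p (pair_code n (strand 0 z n)), forall n, p' (pair_code n (strand 1 z n)),
    forall n i, p (pair_code n i) -> d (g (strand 2 z)).1 (q i) <= n.+1%:R^-1 &
    forall n i, p' (pair_code n i) -> d (g (strand 2 z)).2 (q i) <= n.+1%:R^-1].

Lemma code_relP p p' : (exists z, code_rel p p' z) <->
  exists x x', [/\ codes p x, codes p' x' & E x x'].
Proof.
split=> [[z [h1 h2 h3 h4]]|[x [x' [[hx1 hx2] [hx1' hx2'] Exx']]]].
  exists (g (strand 2 z)).1, (g (strand 2 z)).2; split.
  - by split=> // n; exists (strand 0 z n).
  - by split=> // n; exists (strand 1 z n).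
  - suff : [set p : X * X | E p.1 p.2] (g (strand 2 z)) by [].
    by rewrite -g_range; exists (strand 2 z).
have [a ha] := choice hx1; have [a' ha'] := choice hx1'.
have [c _ hc] : range g (x, x') by rewrite g_range.
have [z [z0 z1 z2 _ _]] := strands_exist a a' c (fun=> 0%N) 0%N.
by exists z; rewrite /code_rel z0 z1 z2 hc.
Qed.

Lemma dist_closed (h : baire_space -> X) y (r : R) (c : nat -> nat) : continuous h ->
  (forall m, exists c' : nat -> nat, agree m c c' /\ d (h c') y <= r) -> d (h c) y <= r.
Proof.
move=> hc H; rewrite leNgt; apply/negP => rh.
have oO : open [set x | r < d x y].
  apply/d_open => x /= rx; exists (d x y - r); first by rewrite subr_gt0.
  move=> x' /= xx'; rewrite ltrBrDl -ltrBrDr in xx'; apply: lt_le_trans xx' _.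
  by rewrite lerBlDl d_tri.
have /hc/nbhs_seq_space[m hm] : nbhs (h c) [set x | r < d x y] by exact: open_nbhs_nbhs.
by have [c' [cc' hr]] := H m; have := hm c' cc'; rewrite /= ltNge hr.
Qed.

Lemma code_rel_closed p p' z :
  (forall n, exists p1 p1' z1, code_rel p1 p1' z1 /\
     [/\ agree n p p1, agree n p' p1' & agree n z z1]) -> code_rel p p' z.
Proof.
move=> H.
have approx1 k m : exists p1 p1' z1, [/\ code_rel p1 p1' z1, p k = p1 k, p' k = p1' k &
    forall j, (j < 5)%N -> agree m (strand j z) (strand j z1)].
  have [p1 [p1' [z1 [h1 [h2 h3 h4]]]]] := H (5 * m + k.+1)%N.
  exists p1, p1', z1; split => //; [by apply: h2; lia|by apply: h3; lia|].
  by move=> j j5; apply: strand_agree => //; apply: agree_le h4; lia.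
split.
- move=> n; have [p1 [p1' [z1 [[h _ _ _] -> _ hz]]]] :=
    approx1 (pair_code n (strand 0 z n)) n.+1.
  by rewrite (hz 0%N).
- move=> n; have [p1 [p1' [z1 [[_ h _ _] _ -> hz]]]] :=
    approx1 (pair_code n (strand 1 z n)) n.+1.
  by rewrite (hz 1%N).
- move=> n i pni; apply: (dist_closed (h := fun c => (g c).1)).
    by move=> c; apply: continuous_comp; [exact: g_cont|exact: cvg_fst].
  move=> m; have [p1 [p1' [z1 [[_ _ h _] pk _ hz]]]] := approx1 (pair_code n i) m.
  by exists (strand 2 z1); split; [exact: hz|apply: h; rewrite -pk].
move=> n i pni; apply: (dist_closed (h := fun c => (g c).2)).
  by move=> c; apply: continuous_comp; [exact: g_cont|exact: cvg_snd].
move=> m; have [p1 [p1' [z1 [[_ _ _ h] _ pk hz]]]] := approx1 (pair_code n i) m.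
by exists (strand 2 z1); split; [exact: hz|apply: h; rewrite -pk].
Qed.

(** A pair in [E] gives a chain with one genuine step. Conversely, the limit chain is followed step
    by step, using uniqueness of coded points and transitivity of [E]. *)
Lemma approx_codeP x y :
  E x y <-> exists b, forall n, approx code_rel n b (code x) (code y).
Proof.
have [Er Es Et] := E_equiv; split=> [Exy|[b hb]].
  have /code_relP[z hz] : exists x1 x2, [/\ codes (code x) x1, codes (code y) x2 & E x1 x2].
    by exists x, y; split => //; exact: code_codes.
  (* The successor guarantees at least one step; the steps after the first are idle. *)
  exists (fun j => (z j).+1) => n.
  exists (fun i => if i is 0%N then code x else code y); split => //.
  move=> [|i] _; last by left.
  right; exists (code x), (code y), z; split => //; split=> // j _; exact: leqW.
have [P [P0 Pb hP]] := approx_limit code_rel_closed hb.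
have chain i : (i <= b 0)%N -> exists z, codes (P i) z /\ E x z.
  elim: i => [|i IH] ib; first by exists x; rewrite P0; split; [exact: code_codes|].
  have [z [cz Exz]] := IH (ltnW ib).
  have [<-|/code_relP[x1 [x2 [c1 c2 E12]]]] := hP i ib; first by exists z.
  exists x2; split => //; apply: Et Exz _.
  by rewrite (codes_unique cz c1).
have [z [cz Exz]] := chain _ (leqnn _).
by rewrite Pb in cz; rewrite (codes_unique (code_codes y) cz).
Qed.

Lemma borel_code k : borel_set [set x | code x k].
Proof.
rewrite /code; case: unpickle => [[n i]|]; last first.
  rewrite (_ : [set x | _] = set0); first exact: borel_set0.
  by apply/seteqP; split.
apply: borel_open; apply/d_open => x /= xi.
exists (n.+1%:R^-1 - d x (q i)); first by rewrite subr_gt0.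
move=> y /= xy; rewrite (le_lt_trans (d_tri y x (q i)))// (d_sym y x).
by rewrite -ltrBrDr.
Qed.

End CodePoints.

(** * Assembling the reduction *)

Lemma node_indexing : exists (idx : nat -> node * nat) (idx_inv : node * nat -> nat),
  cancel idx idx_inv /\ cancel idx_inv idx.
Proof.
have inj1 : injective (fun n : nat => (([::], [::]), n) : node * nat) by move=> m n [].
have inj2 : injective (pickle : node * nat -> nat) by exact: (pcan_inj pickleK).
have [h [[h' hK h'K] _]] := cantor_bernstein_graph inj1 inj2.
by exists h, h'.
Qed.

Lemma dense_sequence (R : realType) (X : topologicalType) (d : X -> X -> R) (x0 : X)
    (D : set X) :
  (forall x y z, d x z <= d x y + d y z) -> (forall x, d x x = 0) ->
  (forall A : set X, open A <->
    (forall x, A x -> exists2 e : R, 0 < e & [set y | d x y < e] `<=` A)) ->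
  countable D -> dense D ->
  exists q : nat -> X, forall x (e : R), 0 < e -> exists i, d x (q i) < e.
Proof.
move=> d_tri d0 d_open /countable_injP[f finj] dD.
exists (fun i => xget x0 [set x | D x /\ f x = i]) => x e e0.
have [||z [/= xz Dz]] := dD [set y | d x y < e].
- by exists x; rewrite /= d0.
- apply/d_open => y /= xy; exists (e - d x y); first by rewrite subr_gt0.
  move=> z /= yz; rewrite (le_lt_trans (d_tri x y z))//.
  by rewrite -ltrBrDl.
exists (f z); case: xgetP => [z' _ [Dz' fz']|/(_ z)[]//].
by rewrite (finj z' z)// inE.
Qed.

Lemma coded_basis_unconditional (R : realType) (idx : nat -> node * nat) :
  unconditional_basic_seq (@coded_basis R idx).
Proof.
apply: solid_basis_unconditional; first exact: tree_weight_ge0.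
exact: (tree_weight_norming R node_label (node_of idx) node_cmp_refl).
Qed.

Lemma coded_basis_transfer (R : realType) (idx : nat -> node * nat)
    (V : completeNormedModType R) (u : nat -> V) (s tau : nat -> nat) :
  basic_seq u -> (forall n, (s n < s n.+1)%N) -> seq_equiv (@coded_basis R idx) (u \o s) ->
  injective tau -> seq_equiv (@coded_basis R idx \o tau) (u \o s \o tau).
Proof.
apply: solid_transfer; first exact: tree_weight_ge0.
exact: (tree_weight_norming R node_label (node_of idx) node_cmp_refl).
Qed.

Unset Implicit Arguments.

Theorem mainTheorem6 (R : realType) (V : completeNormedModType R) (u : nat -> V)
  (hu : universal_unconditional u) :
  analytic_set [set p : cantor_space * cantor_space |
              [/\ infinite_omega p.1, infinite_omega p.2 & ubs_perm_equiv u p.1 p.2]]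
  /\
  (forall (X : topologicalType), polish_space R X ->
   forall E : X -> X -> Prop, equiv_relation E ->
     analytic_set [set p : X * X | E p.1 p.2] ->
     exists f : X -> cantor_space,
       [/\ borel_fun f, (forall x, infinite_omega (f x))
         & forall x y, E x y <-> ubs_perm_equiv u (f x) (f y)]).
Proof.
have [[bu _] uu] := hu.
split; first exact: perm_equiv_analytic.
move=> X [[D [cD dD]] [d [d_eq0 d_sym d_tri d_open _]]] E Eeq [E0|[g [g_cont g_range]]].
  (* An empty reflexive relation lives on an empty space. *)
  have noX (x : X) : False.
    have [Er _ _] := Eeq.
    suff : [set p : X * X | E p.1 p.2] (x, x) by rewrite E0.
    exact: Er.
  exists (fun=> fun=> true); split => [B _|x|x]; [|by have := noX x|by have := noX x].
  rewrite (_ : _ @^-1` _ = set0); first exact: borel_set0.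
  by apply/seteqP; split => x; have := noX x.
have d0 x : d x x = 0 by apply/d_eq0.
have [q q_dense] := dense_sequence (g (fun=> 0%N)).1 d_tri d0 d_open cD dD.
have [idx [idx_inv [idxK idx_invK]]] := node_indexing.
pose C := code_rel d q g.
have C_closed := code_rel_closed d_tri d_open g_cont (q := q).
pose w := @coded_basis R idx.
have w_unc : unconditional_basic_seq w by exact: coded_basis_unconditional.
have [s [hs ws]] := uu _ w w_unc.
(* [A x] is the set of indices attached to the tree of [x]; [f x] is its image under [s], which
   places the coded basis inside [u]. *)
pose A x : nat -> bool := fun j => `[< coded_set C idx (code d q x) j >].
pose f x : nat -> bool := fun k => `[< exists2 j, s j = k & A x j >].
have fP x k : f x k <-> exists2 j, s j = k & A x j.
  by split => [/asboolP//|h]; apply/asboolP.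
have A_inf x : infinite_omega (A x).
  (* The root lies in every tree and carries infinitely many indices. *)
  move=> m; have [M hM] := injective_unbounded
    (fun i i' h => congr1 snd (can_inj idx_invK h) : i = i')
      (tau := fun i => idx_inv (node_at (code d q x) 0, i)) m.
  exists (idx_inv (node_at (code d q x) 0, M)); split; first exact: hM.
  apply/asboolP; rewrite /coded_set /= /node_of idx_invK; exact: node_at_in.
have /choice[r hr] x : exists r, enumerates (A x) r by exact: infinite_enumerates.
have fr x : enumerates (f x) (s \o r x) by exact: (enumerates_comp hs (fP x) (hr x)).
have ri x : injective (r x) by apply: increasing_inj; exact: (hr x).1.
have rA x j : coded_set C idx (code d q x) j <-> exists n, r x n = j.
  by rewrite -(hr x).2; split => [h|/asboolP//]; apply/asboolP.
exists f; split.
- apply: borel_fun_cantor => k.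
  have [[j hj]|nj] := pselect (exists j, s j = k); last first.
    rewrite (_ : [set x | _] = set0); first exact: borel_set0.
    by apply/seteqP; split => // x /fP[j hj _]; apply: nj; exists j.
  rewrite (_ : [set x | _] = [set x | node_in C (code d q x) (node_of idx j)]).
    (* Membership of a node in the tree depends only on as many bits of the code as the length of
       the node. *)
    apply: (@borel_finitary _ _ (borel_code d_sym d_tri d_open q) (size (node_of idx j).2)
      (fun p => node_in C p (node_of idx j))) => p p' pp' [sz h]; split => //.
    exact: approx_agree h.
  apply/seteqP; split => x /=.
    by move=> /fP[j' hj' /asboolP]; rewrite -hj in hj'; rewrite (increasing_inj hs hj').
  by move=> h; apply/fP; exists j => //; apply/asboolP.
- move=> x; exact: enumerates_infinite (fr x).
move=> x y; have codeP x' y' := approx_codeP d_eq0 d_sym d_tri d_open q_dense Eeq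
  g_cont g_range x' y'.
(* This moves the equivalence between the coded basis and [u], for the enumerations of [A x] and
   [A y] and their permutations. *)
have transfer tau : injective tau -> seq_equiv (w \o tau) (u \o s \o tau).
  by move=> ti; exact: coded_basis_transfer.
split=> [Exy|[s1 [t1 [es et hst]]]].
  have [_ Es _] := Eeq.
  have [b hb] := (codeP x y).1 Exy; have [b' hb'] := (codeP y x).1 (Es _ _ Exy).
  have [h [hbij hequiv]] := approx_perm_equiv R idxK idx_invK (ri x) (ri y) (rA x) (rA y) hb hb'.
  exists (s \o r x), (s \o r y); split => //; exists h; split => // a.
  have t1 := transfer _ (ri x) a.
  have t2 := transfer _ (inj_comp (ri y) (bij_inj hbij)) a.
  exact: iff_trans (iff_sym t1) (iff_trans (hequiv a) t2).
apply/codeP; apply: (perm_equiv_approx idx_invK (ri x) (ri y) (rA x) (rA y) (R := R)).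
have [h [hbij hequiv]] := hst.
rewrite (enumerates_unique es (fr x)) (enumerates_unique et (fr y)) in hequiv.
exists h; split => // a.
have t1' := transfer _ (ri x) a.
have t2' := transfer _ (inj_comp (ri y) (bij_inj hbij)) a.
exact: iff_trans t1' (iff_trans (hequiv a) (iff_sym t2')).
Qed.
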